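(* Consider the distributed algorithm described in the context. Assume: (1) (Bounded information) There is a constant $B>0$ such that $\max_{i}\max_{\theta',\theta''\in\Theta}\max_{x\in\mathbb{R}}\sup_{y}\left|\log\frac{f_i(y|x,\theta')}{f_i(y|x,\theta'')}\right|<B$, and for each $i\in\mathcal N$ and $\theta\in\Theta$, $f_i(y|x,\theta)$ is continuous in $x$. (2) (Network) The graph $\mathcal G$ is static, undirected and connected, $W$ is nonnegative and doubly stochastic ($W\boldsymbol 1=\boldsymbol 1$, $\boldsymbol 1^TW=\boldsymbol 1^T$), and the spectral radius $\rho_w$ of $W-\frac{\boldsymbol 1\boldsymbol 1^T}{N}$ lies in $[0,1)$. (3) (Stepsize) $0<\alpha^{(t)}<1$ for all $t$, $\sum_{t=0}^\infty\alpha^{(t)}=\infty$, $\sum_{t=0}^\infty(\alpha^{(t)})^2<\infty$, and $\alpha^{(t)}=\mathcal O(1/t)$. (4) (Costs) There are $\mu,L>0$ such that for every $i\in\mathcal N$, $\theta\in\Theta$ and $x,x'\in\mathbb{R}$: $(\nabla_xJ_i(x',\theta)-\nabla_xJ_i(x,\theta))(x'-x)\ge\mu\|x'-x\|^2$ and $\|\nabla_xJ_i(x',\theta)-\nabla_xJ_i(x,\theta)\|\le L\|x'-x\|$. Let $\tilde{\boldsymbol q}$ be the (almost sure) common limit of the agents' beliefs. Then, almost surely, for every agent $i\in\mathcal N$, $$\lim_{t\to\infty}x_i^{(t)}=x^*(\tilde{\boldsymbol q}).$$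
   Context: Agents: $\mathcal N=\{1,\dots,N\}$. Parameter set: $\Theta=\{\theta_1,\dots,\theta_M\}$, finite; $\theta_*\in\Theta$ is the (unknown) true parameter. Agent $i$ has a cost $J_i(x,\theta)$, $x\in\mathbb{R}$, differentiable in $x$. For decision $x$ and parameter $\theta$, $f_i(\cdot|x,\theta)$ is the probability density (likelihood) of agent $i$'s noisy observation $y_i=J_i(x,\theta)+\epsilon_i$, where $\epsilon_i$ is random noise. Network: graph $\mathcal G$ on $\mathcal N$ with neighbour sets $\mathcal N_i$ and weight matrix $W=[w_{ij}]_{N\times N}$, $w_{ij}>0$ if $j\in\mathcal N_i$ and $w_{ij}=0$ otherwise. $\boldsymbol 1$ is the all-ones vector. Algorithm, with stepsizes $\alpha^{(t)}$: initial decisions $x_i^{(0)}\in\mathbb{R}$ are given, $y_i^{(0)}$ is observed at $x_i^{(0)}$, and $q_i^{(0)}(\theta_m)=1/M$ for all $i,m$. For $t=0,1,2,\dots$ and each $i\in\mathcal N$: $$b_i^{(t)}(\theta_m)=\frac{f_i(y_i^{(t)}|x_i^{(t)},\theta_m)^{\alpha^{(t)}}q_i^{(t)}(\theta_m)}{\sum_{\theta\in\Theta}f_i(y_i^{(t)}|x_i^{(t)},\theta)^{\alpha^{(t)}}q_i^{(t)}(\theta)},\qquad q_i^{(t+1)}(\theta_m)=\frac{\exp\left(\sum_{j=1}^Nw_{ij}\log b_j^{(t)}(\theta_m)\right)}{\sum_{\theta\in\Theta}\exp\left(\sum_{j=1}^Nw_{ij}\log b_j^{(t)}(\theta)\right)},$$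 $$x_i^{(t+1)}=\sum_{j=1}^Nw_{ij}\Big[x_j^{(t)}-\alpha^{(t)}\sum_{\theta\in\Theta}q_j^{(t+1)}(\theta)\nabla_xJ_j(x_j^{(t)},\theta)\Big],$$ and then the new data $y_i^{(t+1)}=J_i(x_i^{(t+1)},\theta_* )+\epsilon_i$ is observed with fresh noise; i.e. conditionally on the past (all $(x_j^{(s)},y_j^{(s)})$, $s<t$, $j\in\mathcal N$, which determine $x_i^{(t)}$), $y_i^{(t)}$ has density $f_i(\cdot|x_i^{(t)},\theta_* )$. Limiting belief: under hypotheses (1)-(3), almost surely the limits $\nu_m=\lim_{t\to\infty}\frac1N\sum_{i=1}^N q_i^{(t)}(\theta_m)/q_i^{(t)}(\theta_* )$ exist and every agent's belief vector $\boldsymbol q_i^{(t)}=(q_i^{(t)}(\theta_1),\dots,q_i^{(t)}(\theta_M))^T$ converges to the common vector $\tilde{\boldsymbol q}$ with entries $\tilde q(\theta_m)=\nu_m/\sum_{l=1}^M\nu_l$. For a probability vector $\boldsymbol q=(q(\theta_1),\dots,q(\theta_M))^T$, $F_i(x,\boldsymbol q)=\sum_{m=1}^Mq(\theta_m)J_i(x,\theta_m)$ and $x^*(\boldsymbol q)=\arg\min_{x\in\mathbb{R}}\frac1N\sum_{i=1}^NF_i(x,\boldsymbol q)$. $\alpha^{(t)}=\mathcal O(1/t)$ means there is a constant $C$ with $\alpha^{(t)}\le C/t$ for all $t\ge1$. *)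

(* Defs.v *)
From HB Require Import structures.
From mathcomp Require Import all_boot all_order all_algebra.
From mathcomp Require Import complex.
From mathcomp Require Import all_classical all_reals all_analysis.

Set Implicit Arguments.
Unset Strict Implicit.
Unset Printing Implicit Defensive.

Import Order.TTheory GRing.Theory Num.Theory.
Import numFieldNormedType.Exports.

Local Open Scope classical_set_scope.
Local Open Scope ring_scope.

(* Conventions: agents are 'I_N, the parameter set is a finType Theta;         *)
(* J i th x is J_i(x, th), f i th x y is f_i(y | x, th). Processes take the    *)
(* time first: x t i w, q t i th w, y t i w.                                   *)

Section Network.
Context {R : realType} {N : nat}.

(* The matrix W - (1 1^T)/N is not symmetric in general, so its eigenvalues    *)
(* are taken in the complex numbers.                                           *)
Definition spectral_radius (A : 'M[R]_N) : R :=
  sup [set r | exists2 l : R[i],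
    eigenvalue (map_mx (real_complex R) A) l & `|l| = real_complex R r].

Definition consensus_residual (W : 'M[R]_N) : 'M[R]_N :=
  W - (N%:R)^-1 *: const_mx 1.

Definition doubly_stochastic (W : 'M[R]_N) : Prop :=
  [/\ forall i j, 0 <= W i j,
      W *m const_mx 1 = const_mx 1 :> 'cV_N &
      const_mx 1 *m W = const_mx 1 :> 'rV_N].

(* N_i is the set of j with g i j; self-loops are allowed but not required.    *)
Definition weights_of_graph (g : rel 'I_N) (W : 'M[R]_N) : Prop :=
  forall i j, (g i j -> 0 < W i j) /\ (~~ g i j -> W i j = 0).

Definition network_assumption (g : rel 'I_N) (W : 'M[R]_N) : Prop :=
  [/\ symmetric g, forall i j, connect g i j, doubly_stochastic W &
      0 <= spectral_radius (consensus_residual W) < 1].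

End Network.

Section Stepsize.
Context {R : realType}.

Definition stepsize_assumption (alpha : nat -> R) : Prop :=
  [/\ forall t, 0 < alpha t < 1,
      (\sum_(0 <= t <oo) (alpha t)%:E = +oo)%E,
      (\sum_(0 <= t <oo) ((alpha t) ^+ 2)%:E < +oo)%E &
      exists C : R, forall t, (1 <= t)%N -> alpha t <= C / t%:R].

End Stepsize.

Section Costs.
Context {R : realType} {N : nat} {Theta : finType}.
Variable J : 'I_N -> Theta -> R -> R.

Definition costs_assumption : Prop :=
  exists mu L : R, [/\ 0 < mu, 0 < L &
    forall i th x x',
      mu * `|x' - x| ^+ 2 <=
        (derive1 (J i th) x' - derive1 (J i th) x) * (x' - x) /\
      `|derive1 (J i th) x' - derive1 (J i th) x| <= L * `|x' - x|].

Definition expected_cost (i : 'I_N) (x : R) (q : Theta -> R) : R :=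
  \sum_th q th * J i th x.

Definition average_cost (x : R) (q : Theta -> R) : R :=
  N%:R^-1 * \sum_(i < N) expected_cost i x q.

Definition minimizers (q : Theta -> R) : set R :=
  [set x | forall z, average_cost x q <= average_cost z q].

(* Meaningful when minimizers q is nonempty; arbitrary otherwise. *)
Definition xstar (q : Theta -> R) : R := get (minimizers q).

End Costs.

Section Likelihoods.
Context {R : realType} {N : nat} {Theta : finType}.
Variable f : 'I_N -> Theta -> R -> R -> R.

Definition probability_densities : Prop :=
  forall i th x,
    [/\ forall y, 0 <= f i th x y, measurable_fun setT (f i th x) &
        (\int[lebesgue_measure]_y (f i th x y)%:E = 1)%E].

(* ln and division are total, so the positivity of f, which the finiteness of  *)
(* every log-likelihood ratio presupposes, has to be stated.                   *)
Definition bounded_information : Prop :=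
  [/\ forall i th x y, 0 < f i th x y,
      exists2 B : R, 0 < B &
        forall i th' th'' x y, `|ln (f i th' x y / f i th'' x y)| < B &
      forall i th y, continuous (fun x => f i th x y)].

End Likelihoods.

Section Process.
Context {R : realType} {d : measure_display} {T : measurableType d}.
Context {N : nat}.

(* The sigma-algebra generated by all x_j^(s), y_j^(s) with s < t. *)
Definition past (x y : nat -> 'I_N -> T -> R) (t : nat) : set (set T) :=
  <<s \bigcup_(s in [set s | (s < t)%N]) \bigcup_j
        (preimage_set_system setT (x s j) measurable `|`
         preimage_set_system setT (y s j) measurable) >>.

(* Conditionally on past x y t, the law of y_i^(t) has density h (x_i^(t)).    *)
Definition has_conditional_density (P : probability T R)
    (x y : nat -> 'I_N -> T -> R) (t : nat) (i : 'I_N) (h : R -> R -> R) :=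
  forall (E : set T) (A : set R), past x y t E -> measurable A ->
    (P (E `&` y t i @^-1` A) =
     \int[P]_(w in E) \int[lebesgue_measure]_(z in A) (h (x t i w) z)%:E)%E.

End Process.

Section Algorithm.
Context {R : realType} {T : Type} {N : nat} {Theta : finType}.

(* Bayesian update with the likelihood raised to the power a. *)
Definition bayes (h : Theta -> R) (a : R) (q : Theta -> R) (th : Theta) : R :=
  (h th `^ a * q th) / \sum_th' (h th' `^ a * q th').

Definition log_pool (W : 'M[R]_N) (b : 'I_N -> Theta -> R)
    (i : 'I_N) (th : Theta) : R :=
  expR (\sum_j W i j * ln (b j th)) /
  \sum_th' expR (\sum_j W i j * ln (b j th')).

Record distributed_algorithm (J : 'I_N -> Theta -> R -> R)
    (f : 'I_N -> Theta -> R -> R -> R) (W : 'M[R]_N) (alpha : nat -> R)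
    (x0 : 'I_N -> R) (thstar : Theta) (eps : nat -> 'I_N -> T -> R)
    (x y : nat -> 'I_N -> T -> R) (q : nat -> 'I_N -> Theta -> T -> R) : Prop :=
  DistributedAlgorithm {
    decision_init : forall i w, x 0 i w = x0 i;
    belief_init : forall i th w, q 0 i th w = #|Theta|%:R^-1;
    observation : forall t i w, y t i w = J i thstar (x t i w) + eps t i w;
    belief_step : forall t i th w,
      q t.+1 i th w =
      log_pool W (fun j => bayes (fun th' => f j th' (x t j w) (y t j w))
                                 (alpha t) (fun th' => q t j th' w)) i th;
    decision_step : forall t i w,
      x t.+1 i w =
      \sum_j W i j * (x t j w - alpha t *
        \sum_th q t.+1 j th w * derive1 (J j th) (x t j w))
  }.

(* Along one sample path p t i th of the beliefs: qt is the common limit.      *)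
Definition limiting_belief (thstar : Theta)
    (p : nat -> 'I_N -> Theta -> R) (qt : Theta -> R) : Prop :=
  exists nu : Theta -> R,
    [/\ forall th,
          N%:R^-1 * \sum_(i < N) (p t i th / p t i thstar)
            @[t --> \oo] --> nu th,
        forall th, qt th = nu th / \sum_th' nu th' &
        forall i th, p t i th @[t --> \oo] --> qt th].

End Algorithm.

(* Main.v *)
Require Import Defs.
From HB Require Import structures.
From mathcomp Require Import all_boot all_order all_algebra.
From mathcomp Require Import complex.
From mathcomp Require Import all_classical all_reals all_analysis.
From mathcomp Require Import measurable_realfun ring lra zify.

Set Implicit Arguments.
Unset Strict Implicit.
Unset Printing Implicit Defensive.

Import Order.TTheory GRing.Theory Num.Theory.
Import numFieldNormedType.Exports.

Local Open Scope classical_set_scope.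
Local Open Scope ring_scope.

(** For fixed th, the log-ratios lam_i = ln (q_i(th) / q_i(thstar)) obey the
    linear recursion lam' = W (lam + alpha ell), ell being the bounded
    log-likelihood ratios, so consensus forces lam_i - mean lam -> 0.  The
    conditional mean of ell is - KL <= 0, and the innovations alpha (ell - E ell)
    are orthogonal and O(1/t); hence their series converges almost surely, mean lam
    is a convergent sequence plus a nonincreasing one, and exp (mean lam) converges.
    Along such a sample path the decisions run inexact gradient steps on the
    limiting strongly convex cost: consensus reduces them to their mean, which
    contracts towards the minimizer up to a vanishing error. *)

(** The mean log-ratio may drift to minus infinity, which is how a false parameter is excluded.
    Limits are therefore taken after exponentiation, and the ratio at [thstar], constantly 1, keeps
    the limiting normaliser positive. Two obstacles shape the rest. [W] is not assumed symmetric, so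
    a spectral radius below 1 does not give an operator norm below 1, and stability is drawn from
    the characteristic polynomial instead. The sampling hypothesis describes each agent's
    observation separately, so orthogonality holds between distinct times and not between agents at
    the same time; this suffices because each time contributes one average over the agents.
    Probability enters through a single event, the convergence of the innovation series for all of
    the finitely many parameters; all that follows is deterministic on a fixed sample path. *)

(** * Scalar contraction recursions *)

(** Cutting [a] off at e/2 absorbs the error: the excess [b] satisfies b(t+1) <= (1 - c t) b(t)
    eventually. Since (1 - u)(1 + s + u) <= 1 + s for s, u >= 0, the product of [b] with 1 plus the
    partial sums of [c] does not increase, and the divergence of these sums brings [b] below e/2. *)
Lemma contraction_cvg0 (R : realType) (a c d : nat -> R) :
  (forall t, 0 <= a t) -> (forall t, 0 <= c t) ->
  (\forall t \near \oo, a t.+1 <= (1 - c t) * a t + c t * d t) ->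
  (\forall t \near \oo, c t <= 1) ->
  d t @[t --> \oo] --> 0 ->
  series c @ \oo --> +oo ->
  a t @[t --> \oo] --> 0.
Proof.
move=> a0 c0 [T1 _ aP] [T2 _ c1] d0 cy.
apply/cvgrPdist_le => e e0.
have e2 : 0 < e / 2 by rewrite divr_gt0.
move/cvgrPdist_le : d0 => /(_ _ e2)[T3 _ dP].
pose T0 := maxn T1 (maxn T2 T3).
pose b t := Num.max (a t - e / 2) 0.
pose S n := \sum_(T0 <= i < T0 + n) c i.
have S0 n : 0 <= S n by apply: sumr_ge0.
have b0 t : 0 <= b t by rewrite /b le_max lexx orbT.
have bS n : b (T0 + n)%N * (1 + S n) <= b T0.
  elim: n => [|n IH]; first by rewrite /S addn0 big_geq// addr0 mulr1.
  apply: le_trans IH.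
  set t := (T0 + n)%N.
  have [h1 h2 h3] : [/\ (T1 <= t)%N, (T2 <= t)%N & (T3 <= t)%N].
    by rewrite /t /T0; split; lia.
  have bt : b t.+1 <= (1 - c t) * b t.
    have ct : 0 <= 1 - c t by rewrite subr_ge0 c1.
    rewrite {1}/b ge_max mulr_ge0// andbT.
    have := aP _ h1; have := dP _ h3 => /=.
    rewrite sub0r normrN => /ler_normlW dt at1.
    have : (1 - c t) * (a t - e / 2) <= (1 - c t) * b t.
      by rewrite ler_wpM2l// /b le_max lexx.
    have : c t * d t <= c t * (e / 2) by rewrite ler_wpM2l.
    by move: at1; clear; lra.
  rewrite /S addnS big_nat_recr/= ?leq_addr//= -/(S n) -/t.
  have := S0 n; have := c0 t; have := b0 t; have ct1 := c1 _ h2.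
  move: bt ct1; set x := b t; set y := b _; set s := S n; set u := c t => /= *.
  apply: (@le_trans _ _ ((1 - u) * x * (1 + (s + u)))).
    by rewrite ler_wpM2r//; lra.
  have -> : (1 - u) * x * (1 + (s + u)) = x * (1 + s) - x * u * (s + u) by ring.
  by rewrite gerBl mulr_ge0 ?mulr_ge0 ?addr_ge0.
(* From this threshold on, the sum started at [T0] is at least 2 b(T0) / e; the absolute value pays
   for the terms before [T0]. *)
have [T4 _ cP] : \forall n \near \oo, 2 * b T0 / e + `|series c T0| <= series c n.
  by move/cvgryPge : cy; exact.
exists (T0 + T4)%N => // t /= tT; rewrite sub0r normrN ger0_norm//.
have -> : t = (T0 + (t - T0))%N by lia.
set n := (t - T0)%N.
have hS : 2 * b T0 / e <= S n.
  have /= := cP (T0 + n)%N; rewrite /= => /(_ _)/wrap[]; first lia.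
  rewrite -[series c (T0 + n)%N](subrK (series c T0)) sub_series_geq ?leq_addr// -/(S n).
  move=> h; rewrite -(lerD2r (series c T0)); apply: le_trans h.
  by rewrite lerD2l ler_norm.
have bn : b (T0 + n)%N <= e / 2.
  apply: contraT; rewrite -ltNge => eb; rewrite ler_pdivrMr// in hS.
  have : e / 2 * (1 + S n) < b (T0 + n)%N * (1 + S n) by rewrite ltr_pM2r// ltr_pwDl.
  by move/lt_le_trans => /(_ _ (bS n)); move: hS e0; clear; nra.
have : a (T0 + n)%N - e / 2 <= b (T0 + n)%N by rewrite /b le_max lexx.
lra.
Qed.

Lemma cvg_sum (R : realType) (I : finType) (F : I -> nat -> R) (l : I -> R) :
  (forall i, F i t @[t --> \oo] --> l i) ->
  \sum_i F i t @[t --> \oo] --> \sum_i l i.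
Proof.
move=> Fl; rewrite [X in X @ _ --> _](_ : _ = \sum_i F i); last first.
  by apply/funext => t; rewrite fct_sumE.
elim/big_ind2 : _ => [|u a v b ua vb|i _]; [exact: cvg_cst|exact: cvgD|exact: Fl].
Qed.

Lemma sum_cvg0 (R : realType) (I : finType) (F : I -> nat -> R) :
  (forall i, F i t @[t --> \oo] --> 0) -> \sum_i F i t @[t --> \oo] --> 0.
Proof. by move=> /cvg_sum; rewrite big1. Qed.

(** * Perturbed linear recursions with spectral radius below one *)

Section StableRecursion.
Context {R : realType}.
Local Notation nrm := (@Normc.normc R).

Let nrmD (x y : R[i]) : nrm (x + y) <= nrm x + nrm y.
Proof. exact: le_normcD. Qed.

Let nrm_ge0 (x : R[i]) : 0 <= nrm x.
Proof. by case: x => a b; exact: sqrtr_ge0. Qed.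

Let nrm_sum (I : finType) (F : I -> R[i]) : nrm (\sum_i F i) <= \sum_i nrm (F i).
Proof.
elim/big_ind2 : _ => //; first by rewrite Normc.normc0.
by move=> x1 x2 y1 y2 h1 h2; apply: le_trans (nrmD _ _) (lerD h1 h2).
Qed.

Let mulmx_cvg0 n (A : 'M[R[i]]_n) (s : nat -> 'cV[R[i]]_n) :
  (forall i, nrm (s t i 0) @[t --> \oo] --> 0) ->
  forall i, nrm ((A *m s t) i 0) @[t --> \oo] --> 0.
Proof.
move=> s0 i.
apply: (@squeeze_cvgr _ _ _ _ (fun=> 0) (fun t => \sum_j nrm (A i j) * nrm (s t j 0))).
- apply: nearW => t; rewrite nrm_ge0/= mxE; apply: le_trans (nrm_sum _) _.
  by apply: ler_sum => j _; rewrite Normc.normcM.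
- exact: cvg_cst.
- apply: sum_cvg0 => j; rewrite -[X in _ --> X](mulr0 (nrm (A i j))).
  by apply: cvgM; [exact: cvg_cst|exact: s0].
Qed.

Lemma geometric_recursion_cvg0 (a d : nat -> R) (rho : R) :
  0 <= rho < 1 -> (forall t, 0 <= a t) ->
  (forall t, a t.+1 <= rho * a t + d t) -> d t @[t --> \oo] --> 0 ->
  a t @[t --> \oo] --> 0.
Proof.
move=> /andP[r0 r1] a0 aP d0.
have r1' : 0 < 1 - rho by rewrite subr_gt0.
apply: (@contraction_cvg0 _ a (fun=> 1 - rho) (fun t => d t / (1 - rho))) => //.
- by move=> ?; exact: ltW.
- apply: nearW => t; rewrite subKr mulrCA divff ?gt_eqF// mulr1; exact: aP.
- by apply: nearW => t; rewrite gerBl.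
- by rewrite -[X in _ --> X](mul0r ((1 - rho)^-1)); apply: cvgM => //; exact: cvg_cst.
- have -> : series (fun=> 1 - rho) = (fun n => n%:R * (1 - rho)).
    apply/funext => n; rewrite /series/= sumr_const_nat subn0 mulr_natl//.
  apply: (@cvg_comp _ _ _ (fun n => n%:R) (fun x => x * (1 - rho))).
    exact: cvgr_idn.
  exact: gt0_cvgMly.
Qed.

(** [A] need not be normal, so its eigenvalues do not bound its operator norm; the roots are peeled
    off one at a time instead. If (A - z) Q(A) e tends to 0, then each coordinate of Q(A) e obeys
    the scalar recursion with factor z up to a vanishing error, hence tends to 0 as well. *)
Let roots_cvg0 n (A : 'M[R[i]]_n.+1) (r : seq R[i]) (e s : nat -> 'cV[R[i]]_n.+1) :
  (forall z, z \in r -> nrm z < 1) ->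
  (forall t, e t.+1 = A *m e t + s t) ->
  (forall i, nrm (s t i 0) @[t --> \oo] --> 0) ->
  (forall i, nrm ((horner_mx A (\prod_(z <- r) ('X - z%:P)) *m e t) i 0)
     @[t --> \oo] --> 0) ->
  forall i, nrm (e t i 0) @[t --> \oo] --> 0.
Proof.
move=> r1 eP s0; elim: r r1 => [|z r IH] r1 pe0 i.
  by have := pe0 i; rewrite big_nil rmorph1; under eq_fun do rewrite mul1mx.
apply: IH => {i} [y yr|i]; first by apply: r1; rewrite inE yr orbT.
set Q := horner_mx A _; pose e' t := Q *m e t.
have z1 : nrm z < 1 by apply: r1; rewrite inE eqxx.
pose D t := horner_mx A (\prod_(y <- z :: r) ('X - y%:P)) *m e t + Q *m s t.
apply: (@geometric_recursion_cvg0 (fun t => nrm (e' t i 0))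
  (fun t => nrm (D t i 0)) (nrm z)).
- by rewrite nrm_ge0 z1.
- by move=> t; exact: nrm_ge0.
- move=> t; rewrite -Normc.normcM.
  have -> : e' t.+1 i 0 = z * e' t i 0 + D t i 0; last exact: nrmD.
  have -> : e' t.+1 = z *: e' t + D t; last by rewrite 2!mxE.
  rewrite /D /e' eP big_cons rmorphM/= -/Q rmorphB/= horner_mx_X horner_mx_C.
  rewrite mulmxDr addrA; congr (_ + _).
  rewrite -[(_ - _) * Q]/(_ *m Q) -mulmxA mulmxBl mul_scalar_mx addrC subrK !mulmxA.
  congr (_ *m _); have : horner_mx A 'X * Q = Q * horner_mx A 'X.
    by rewrite /Q -!rmorphM mulrC.
  by rewrite horner_mx_X.
- apply: (@squeeze_cvgr _ _ _ _ (fun=> 0) (fun t =>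
    nrm ((horner_mx A (\prod_(y <- z :: r) ('X - y%:P)) *m e t) i 0) +
    nrm ((Q *m s t) i 0))).
  + by apply: nearW => t; rewrite nrm_ge0/= /D mxE nrmD.
  + exact: cvg_cst.
  + rewrite -[X in _ --> X]addr0; apply: cvgD; first exact: pe0.
    exact: mulmx_cvg0.
Qed.

Lemma eigenvalue_le_spectral_radius n (A : 'M[R]_n) (l : R[i]) :
  eigenvalue (map_mx (real_complex R) A) l -> nrm l <= spectral_radius A.
Proof.
move=> Al; apply: ub_le_sup; last first.
  by exists l => //; rewrite normc_def; case: l {Al}.
have [r rP] := closed_field_poly_normal (char_poly (map_mx (real_complex R) A)).
(* [sup] is informative only on a bounded set: the eigenvalues are among the finitely many roots of
   the characteristic polynomial, and the sum of their moduli bounds each of them. *)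
exists (\sum_(z <- r) nrm z) => x [z]; rewrite eigenvalue_root_char rP.
have /monicP -> := char_poly_monic (map_mx (real_complex R) A).
rewrite scale1r root_prod_XsubC => zr.
rewrite normc_def => -[<-].
have -> : Num.sqrt (complex.Re z ^+ 2 + complex.Im z ^+ 2) = nrm z by case: (z).
by rewrite (big_rem z)//= lerDl sumr_ge0.
Qed.

(** Over the complex numbers the characteristic polynomial splits, and by Cayley-Hamilton it
    annihilates the matrix: the product over all roots sends [e] to 0, which starts the peeling. *)
Lemma spectral_radius_lt1_cvg0 n (A : 'M[R]_n) (e s : nat -> 'cV[R]_n) :
  spectral_radius A < 1 ->
  (forall t, e t.+1 = A *m e t + s t) ->
  (forall i, s t i 0 @[t --> \oo] --> 0) ->
  forall i, e t i 0 @[t --> \oo] --> 0.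
Proof.
case: n A e s => [|n] A e s A1 eP s0 i; first by case: i.
pose E t := map_mx (real_complex R) (e t).
have nrmE (x : R) : nrm (real_complex R x) = `|x| by rewrite /= expr0n addr0 sqrtr_sqr.
suff : nrm (E t i 0) @[t --> \oo] --> 0.
  by under eq_fun do rewrite mxE nrmE; move/norm_cvg0P.
pose S t := map_mx (real_complex R) (s t).
pose B := map_mx (real_complex R) A.
have [r rP] := closed_field_poly_normal (char_poly B).
have /monicP rB := char_poly_monic B; rewrite rB scale1r in rP.
apply: (@roots_cvg0 n B r E S) => {i}.
- move=> z zr; apply: le_lt_trans A1; apply: eigenvalue_le_spectral_radius.
  by rewrite eigenvalue_root_char rP root_prod_XsubC.
- by move=> t; rewrite /E eP map_mxD map_mxM.
- by move=> i; under eq_fun do rewrite mxE nrmE; apply/norm_cvg0P.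
- move=> i; rewrite -rP Cayley_Hamilton.
  under eq_fun do rewrite mul0mx mxE Normc.normc0; exact: cvg_cst.
Qed.

End StableRecursion.

(** * Averages over the agents and consensus *)

Definition mean {R : realType} {n : nat} (z : 'I_n -> R) : R :=
  n%:R^-1 * \sum_i z i.

Section Mean.
Context {R : realType} {n : nat}.
Implicit Types (u v : 'I_n -> R) (c : R).

Lemma mean_cst c : (0 < n)%N -> mean (fun _ : 'I_n => c) = c.
Proof.
move=> n0; rewrite /mean sumr_const card_ord -[c *+ _]mulr_natl mulKf//.
by rewrite pnatr_eq0 -lt0n.
Qed.

Lemma meanB u v : mean u - mean v = mean (fun j => u j - v j).
Proof. by rewrite /mean sumrB mulrBr. Qed.

Lemma meanD u v : mean u + mean v = mean (fun j => u j + v j).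
Proof. by rewrite /mean big_split mulrDr. Qed.

Lemma mean_mull c u : mean (fun j => c * u j) = c * mean u.
Proof. by rewrite /mean -mulr_sumr mulrCA. Qed.

Lemma mean_mulr c u : mean (fun j => u j * c) = mean u * c.
Proof. by rewrite /mean -mulr_suml mulrA. Qed.

Lemma ler_mean u v : (forall j, u j <= v j) -> mean u <= mean v.
Proof. by move=> uv; rewrite ler_wpM2l ?invr_ge0// ler_sum. Qed.

Lemma ler_norm_mean u : `|mean u| <= mean (fun j => `|u j|).
Proof.
by rewrite /mean normrM ger0_norm ?invr_ge0// ler_wpM2l ?invr_ge0// ler_norm_sum.
Qed.

Lemma mean_cvg (u : nat -> 'I_n -> R) (l : 'I_n -> R) :
  (forall j, u t j @[t --> \oo] --> l j) -> mean (u t) @[t --> \oo] --> mean l.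
Proof. by move=> ul; apply: cvgM; [exact: cvg_cst|exact: cvg_sum]. Qed.

End Mean.

Section Consensus.
Context {R : realType} {N : nat} (W : 'M[R]_N).
Hypotheses (N_gt0 : (0 < N)%N) (W_stochastic : doubly_stochastic W).

Lemma doubly_stochastic_row i : \sum_j W i j = 1.
Proof.
case: W_stochastic => _ /matrixP /(_ i 0) + _; rewrite !mxE => <-.
by apply: eq_bigr => j _; rewrite mxE mulr1.
Qed.

Lemma doubly_stochastic_col j : \sum_i W i j = 1.
Proof.
case: W_stochastic => _ _ /matrixP /(_ 0 j); rewrite !mxE => <-.
by apply: eq_bigr => i _; rewrite mxE mul1r.
Qed.

Lemma mean_doubly_stochastic (z : 'I_N -> R) :
  mean (fun i => \sum_j W i j * z j) = mean z.
Proof.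
rewrite /mean exchange_big/=; congr (_ * _); apply: eq_bigr => j _.
by rewrite -mulr_suml doubly_stochastic_col mul1r.
Qed.

(** [W] preserves the mean and the residual matrix kills constant vectors, so the deviations from
    the mean satisfy a closed recursion whose forcing term is the residual applied to [r]. *)
Lemma consensus_cvg (z r : nat -> 'I_N -> R) :
  spectral_radius (consensus_residual W) < 1 ->
  (forall t i, z t.+1 i = \sum_j W i j * (z t j + r t j)) ->
  (forall i, r t i @[t --> \oo] --> 0) ->
  forall i, z t i - mean (z t) @[t --> \oo] --> 0.
Proof.
move=> W1 zP r0 i.
pose A := consensus_residual W.
pose e t : 'cV[R]_N := \col_k (z t k - mean (z t)).
pose s t : 'cV[R]_N := A *m \col_k r t k.
suff : e t i 0 @[t --> \oo] --> 0 by under eq_fun do rewrite mxE.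
have AE (v : 'I_N -> R) k : (A *m \col_j v j) k 0 = \sum_j W k j * v j - mean v.
  rewrite mxE /mean mulr_sumr -sumrB; apply: eq_bigr => j _.
  by rewrite !mxE mulr1 mulrBl.
apply: (@spectral_radius_lt1_cvg0 _ _ A e s) => // [t|k].
  apply/colP => k; rewrite [LHS]mxE [RHS]mxE /s /e !AE -meanB mean_cst// subrr subr0 zP.
  have -> : mean (z t.+1) = mean (z t) + mean (r t).
    by rewrite meanD -(mean_doubly_stochastic (fun k => _ + _)); congr mean; apply/funext => j.
  have -> : \sum_j W k j * (z t j - mean (z t)) = \sum_j W k j * z t j - mean (z t).
    under eq_bigr do rewrite mulrBr.
    by rewrite sumrB -mulr_suml doubly_stochastic_row mul1r.
  by under eq_bigr do rewrite mulrDr; rewrite big_split/=; ring.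
rewrite /s; under eq_fun do rewrite mxE.
apply: sum_cvg0 => j; rewrite -[X in _ --> X](mulr0 (A k j)).
apply: cvgM; first exact: cvg_cst.
under eq_fun do rewrite mxE; exact: r0.
Qed.

End Consensus.

(** * Distributed gradient steps with time-dependent gradients *)

(** Here [d] is a difference of two points and [k] the difference of the gradients there. Up to a
    change of sign d > 0, so k lies between mu d and L d; as a L <= 1 the step does not overshoot,
    and 0 <= d - a k <= (1 - a mu) d. *)
Lemma gradient_step_contraction (R : realDomainType) (mu L a d k : R) :
  0 <= a -> a * L <= 1 ->
  mu * `|d| ^+ 2 <= k * d -> `|k| <= L * `|d| ->
  `|d - a * k| <= (1 - a * mu) * `|d|.
Proof.
move=> a0 aL; have [->|d0] := eqVneq d 0.
  by rewrite normr0 !mulr0 normr_le0 => _ /eqP->; rewrite mulr0 subr0 normr0.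
rewrite real_normK ?num_real//.
wlog dp : d k d0 / 0 < d.
  move=> wl kmu kL; have := d0; rewrite neq_lt => /orP[dn|dp]; last exact: wl.
  have := wl (- d) (- k); rewrite oppr_eq0 d0 => /(_ isT); rewrite !normrN sqrrN mulrNN oppr_gt0 => /(_ dn kmu kL).
  by rewrite mulrN -opprB normrN opprK addrC.
rewrite expr2 mulrA ler_pM2r// (gtr0_norm dp) => kmu /ler_normlW kL.
have : a * k <= a * (L * d) by rewrite ler_wpM2l.
have : a * (mu * d) <= a * k by rewrite ler_wpM2l.
have : a * L * d <= 1 * d by rewrite ler_wpM2r// ltW.
rewrite ler_norml; move=> h1 h2 h3; apply/andP; split; last by lra.
have : d - a * k <= (1 - a * mu) * d by lra.
have : 0 <= d - a * k by lra.
by lra.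
Qed.

Section Decisions.
Context {R : realType} {N : nat} (W : 'M[R]_N).
Variables (alpha : nat -> R) (h : nat -> 'I_N -> R -> R) (H : 'I_N -> R).
Variables (mu L z : R) (x : nat -> 'I_N -> R).
Hypotheses (N_gt0 : (0 < N)%N) (W_stochastic : doubly_stochastic W).
Hypothesis W_radius : spectral_radius (consensus_residual W) < 1.
Hypotheses (alpha_ge0 : forall t, 0 <= alpha t) (alpha_cvg0 : alpha @ \oo --> 0).
Hypothesis alpha_dvg : series alpha @ \oo --> +oo.
Hypotheses (mu_gt0 : 0 < mu) (L_gt0 : 0 < L).
Hypothesis h_monotone : forall t j u v,
  mu * `|v - u| ^+ 2 <= (h t j v - h t j u) * (v - u).
Hypothesis h_lipschitz : forall t j u v, `|h t j v - h t j u| <= L * `|v - u|.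
Hypothesis h_cvg : forall j, h t j z @[t --> \oo] --> H j.
Hypothesis mean_H : mean H = 0.
Hypothesis x_step : forall t i,
  x t.+1 i = \sum_j W i j * (x t j - alpha t * h t j (x t j)).

Let W_ge0 i j : 0 <= W i j. Proof. by case: W_stochastic. Qed.

Let mu_le_L : mu <= L.
Proof.
have N' : 'I_N := Ordinal N_gt0.
have := h_monotone 0 N' 0 1; have := h_lipschitz 0 N' 0 1.
rewrite subr0 normr1 !mulr1 expr1n mulr1 => /ler_normlW hL /le_trans; exact.
Qed.

Let alphaL : \forall t \near \oo, alpha t * L <= 1.
Proof.
have L1 : 0 < L^-1 by rewrite invr_gt0.
apply: filterS (cvgr_lt _ alpha_cvg0 _ L1) => t /ltW.
by rewrite -[L^-1]div1r ler_pdivlMr.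
Qed.

(** A ball around [z] is eventually invariant: the contraction gains alpha mu M, the gradient at [z]
    costs at most alpha K <= alpha mu M, and averaging with [W] is convex. Boundedness must precede
    consensus, because it makes the perturbations alpha h vanish. *)
Let x_bounded : exists M, \forall t \near \oo, forall j, `|x t j - z| <= M.
Proof.
pose D t := \sum_j `|h t j z|.
have D_cvg : D @ \oo --> \sum_j `|H j|.
  by apply: (@cvg_sum _ _ (fun j t => `|h t j z|)) => j; apply: cvg_norm; exact: h_cvg.
pose K := \sum_j `|H j| + 1.
have [T1 _ DK] : \forall t \near \oo, D t <= K.
  have K1 : \sum_j `|H j| < K by rewrite ltrDl.
  by apply: filterS (cvgr_lt _ D_cvg _ K1) => t /ltW.
have [T2 _ aL] := alphaL.
pose T := maxn T1 T2.
(* K / mu pays for the gradients at [z]; the other term puts every decision at time [T] inside the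
   ball. *)
pose M := Num.max (K / mu) (\sum_j `|x T j - z|).
exists M; exists T => // t /= Tt; rewrite -(subnKC Tt).
elim: (t - T)%N => [|n IH] i.
  rewrite addn0 /M le_max; apply/orP; right.
  by rewrite (bigD1 i)//= lerDl sumr_ge0.
rewrite addnS; set s := (T + n)%N in IH *.
have [s1 s2] : (T1 <= s)%N /\ (T2 <= s)%N by rewrite /s /T; split; lia.
have step j : `|x s j - alpha s * h s j (x s j) - z| <= M.
  have -> : x s j - alpha s * h s j (x s j) - z =
    (x s j - z - alpha s * (h s j (x s j) - h s j z)) - alpha s * h s j z by ring.
  apply: le_trans (ler_normB _ _) _; rewrite normrM (ger0_norm (alpha_ge0 s)).
  have := @gradient_step_contraction _ mu L (alpha s) (x s j - z)
    (h s j (x s j) - h s j z) (alpha_ge0 s) (aL _ s2) (h_monotone _ _ _ _) (h_lipschitz _ _ _ _).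
  move=> c; apply: le_trans (lerD c (lexx _)) _.
  have hK : `|h s j z| <= K.
    by apply: le_trans (DK _ s1); rewrite /D (bigD1 j)//= lerDl sumr_ge0.
  have KM : K <= mu * M by rewrite mulrC -ler_pdivrMr// /M le_max lexx.
  have a1 : 0 <= 1 - alpha s * mu.
    by rewrite subr_ge0; apply: le_trans (aL _ s2); rewrite ler_wpM2l.
  have : (1 - alpha s * mu) * `|x s j - z| <= (1 - alpha s * mu) * M by rewrite ler_wpM2l.
  have : alpha s * `|h s j z| <= alpha s * (mu * M).
    by rewrite ler_wpM2l//; exact: le_trans KM.
  lra.
rewrite x_step.
have -> : \sum_j W i j * (x s j - alpha s * h s j (x s j)) - z =
    \sum_j W i j * (x s j - alpha s * h s j (x s j) - z).
  under [RHS]eq_bigr do rewrite mulrBr.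
  by rewrite sumrB -mulr_suml doubly_stochastic_row// mul1r.
apply: le_trans (ler_norm_sum _ _ _) _.
rewrite -[leRHS]mul1r -(doubly_stochastic_row W_stochastic i) mulr_suml.
by apply: ler_sum => j _; rewrite normrM ger0_norm// ler_wpM2l.
Qed.

Let x_consensus i : x t i - mean (x t) @[t --> \oo] --> 0.
Proof.
apply: (consensus_cvg N_gt0 W_stochastic W_radius
  (r := fun t j => - (alpha t * h t j (x t j)))) => // {i} j.
rewrite -oppr0; apply: cvgN; apply/norm_cvg0P.
have [M [T _ MP]] := x_bounded.
apply: (@squeeze_cvgr _ _ _ _ (fun=> 0)
   (fun t => alpha t * (L * M + `|h t j z|))).
- exists T => // t Tt; rewrite normr_ge0/= normrM (ger0_norm (alpha_ge0 t)) ler_wpM2l//.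
  rewrite -[h t j (x t j)](subrK (h t j z)); apply: le_trans (ler_normD _ _) _.
  rewrite lerD2r; apply: le_trans (h_lipschitz _ _ _ _) _.
  by rewrite ler_wpM2l ?(ltW L_gt0)// MP.
- exact: cvg_cst.
- rewrite -(mul0r (L * M + `|H j|)); apply: cvgM => //.
  by apply: cvgD; [exact: cvg_cst|apply: cvg_norm; exact: h_cvg].
Qed.

(** The averaged gradient is strongly monotone at the mean decision [xb]. Replacing the individual
    decisions by [xb] costs [L] times the consensus error, and the averaged gradient at [z] tends to
    mean H = 0; convergence of the gradients is thus required at the single point [z]. *)
Lemma decisions_cvg i : x t i @[t --> \oo] --> z.
Proof.
pose xb t := mean (x t).
suff xbz : `|xb t - z| @[t --> \oo] --> 0.
  have -> : (fun t => x t i) = (fun t => (x t i - xb t) + ((xb t - z) + z)).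
    by apply/funext => t; ring.
  rewrite -[X in _ --> X]add0r; apply: cvgD; first exact: x_consensus.
  rewrite -[X in _ --> X]add0r; apply: cvgD; last exact: cvg_cst.
  by apply/norm_cvg0P.
pose e t := L * mean (fun j => `|x t j - xb t|) + `|mean (fun j => h t j z)|.
apply: (@contraction_cvg0 _ _ (fun t => alpha t * mu) (fun t => e t / mu)) => //.
- by move=> t; rewrite mulr_ge0// ltW.
- apply: filterS alphaL => t aL.
  have -> : alpha t * mu * (e t / mu) = alpha t * e t.
    by field; rewrite gt_eqF.
  have -> : xb t.+1 = xb t - alpha t * mean (fun j => h t j (x t j)).
    rewrite /xb (_ : x t.+1 = fun i => \sum_j W i j * (x t j - alpha t * h t j (x t j))).
      by rewrite mean_doubly_stochastic// -meanB mean_mull.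
    by apply/funext => j; rewrite x_step.
  set m := mean (fun j => h t j (x t j)).
  pose mb := mean (fun j => h t j (xb t)); pose mz := mean (fun j => h t j z).
  have -> : xb t - alpha t * m - z =
    (xb t - z - alpha t * (mb - mz)) - alpha t * ((m - mb) + mz) by ring.
  apply: le_trans (ler_normB _ _) _; apply: lerD.
    apply: (@gradient_step_contraction _ mu L) => //.
      rewrite /mb /mz meanB -mean_mulr -[leLHS](mean_cst _ N_gt0).
      by apply: ler_mean => j; exact: h_monotone.
    rewrite /mb /mz meanB; apply: le_trans (ler_norm_mean _) _; rewrite -[leRHS](mean_cst _ N_gt0).
    by apply: ler_mean => j; exact: h_lipschitz.
  rewrite normrM (ger0_norm (alpha_ge0 t)) ler_wpM2l//.
  apply: le_trans (ler_normD _ _) _; rewrite lerD2r /m /mb meanB.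
  apply: le_trans (ler_norm_mean _) _; rewrite -mean_mull.
  by apply: ler_mean => j; exact: h_lipschitz.
- by apply: filterS alphaL => t; apply: le_trans; rewrite ler_wpM2l.
- rewrite -(mul0r mu^-1); apply: cvgM; last exact: cvg_cst.
  rewrite -[X in _ --> X]addr0; apply: cvgD.
    rewrite -(mulr0 L); apply: cvgM; first exact: cvg_cst.
    rewrite -[X in _ --> X](mean_cst 0 N_gt0); apply: mean_cvg => j.
    by apply/norm_cvg0P; exact: x_consensus.
  by apply/norm_cvg0P; rewrite -mean_H; exact: mean_cvg.
- have -> : series (fun t => alpha t * mu) = (fun n => series alpha n * mu).
    by apply/funext => n; rewrite /series/= mulr_suml.
  apply: (@cvg_comp _ _ _ (series alpha) (fun x => x * mu)); first exact: alpha_dvg.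
  exact: gt0_cvgMly.
Qed.

End Decisions.

(** * Minimizers of strongly convex costs *)

Lemma is_derive_fsum (R : realType) (I : finType) (h : I -> R -> R) (dh : I -> R)
    (x v : R) :
  (forall i, is_derive x v (h i) (dh i)) ->
  is_derive x v (fun y => \sum_i h i y) (\sum_i dh i).
Proof.
move=> hd; rewrite [X in is_derive _ _ X](_ : _ = \sum_i h i); last first.
  by apply/funext => y; rewrite fct_sumE.
elim/big_ind2 : _ => // [|u a w b ua wb]; first exact: is_derive_cst.
exact: is_deriveD.
Qed.

Section StronglyConvex.
Context {R : realType}.
Variables (C G : R -> R) (mu L : R).
Hypotheses (mu_gt0 : 0 < mu)
  (CG : forall x : R, is_derive x 1 C (G x))
  (G_monotone : forall u v, mu * `|v - u| ^+ 2 <= (G v - G u) * (v - u))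
  (G_lipschitz : forall u v, `|G v - G u| <= L * `|v - u|).

Lemma lipschitz_continuous : continuous G.
Proof.
move=> x; apply/subr_cvg0; apply/norm_cvg0P.
apply: (@squeeze_cvgr _ _ _ _ (fun=> 0) (fun y => L * `|y - x|)).
- by apply: nearW => y; rewrite normr_ge0/= G_lipschitz.
- exact: cvg_cst.
- rewrite -[X in _ --> X](mulr0 L); apply: cvgM; first exact: cvg_cst.
  by apply/norm_cvg0P; apply/subr_cvg0; exact: cvg_id.
Qed.

Lemma strongly_monotone_root : exists z, G z = 0.
Proof.
have sq (x : R) : `|x| ^+ 2 = x * x by rewrite real_normK ?num_real// expr2.
(* Beyond distance |G 0| / mu from the origin, strong monotonicity decides the sign of [G]; adding 1
   keeps [A] positive when G 0 = 0. *)
pose A := `|G 0| / mu + 1.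
have A0 : 0 < A by rewrite ltr_wpDl// divr_ge0// ltW.
have muA : `|G 0| <= mu * A by rewrite mulrDr mulrCA divff ?gt_eqF// !mulr1 lerDl ltW.
have G0 := ler_norm (G 0); have G0' := ler_norm (- G 0); rewrite normrN in G0'.
have GA : 0 <= G A.
  have := G_monotone 0 A; rewrite sq subr0 mulrA ler_pM2r//; lra.
have GNA : G (- A) <= 0.
  have := G_monotone 0 (- A); rewrite sq subr0 mulrNN mulrN mulrA -mulNr ler_pM2r//; lra.
have [|||z _ Gz] := @IVT _ G (- A) A 0.
- by lra.
- by apply: continuous_subspaceT; exact: lipschitz_continuous.
- by rewrite ge_min le_max GA GNA orbT.
by exists z.
Qed.

Lemma strongly_convex_minimizer z : G z = 0 -> forall x, x != z -> C z < C x.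
Proof.
move=> Gz x; rewrite neq_lt => /orP[xz|zx].
- have [|c /[!in_itv]/= /andP[xc cz] CE] := MVT xz (fun y _ => CG y).
    apply: derivable_within_continuous => y _.
    by have [] := CG y.
  have := G_monotone c z; rewrite Gz sub0r => h.
  have Gc : G c < 0.
    rewrite -oppr_gt0 -(pmulr_lgt0 _ (_ : 0 < z - c)) ?subr_gt0//.
    by apply: lt_le_trans h; rewrite mulr_gt0// exprn_gt0// normr_gt0 subr_eq0 gt_eqF.
  by rewrite -subr_lt0 CE pmulr_llt0 ?subr_gt0.
- have [|c /[!in_itv]/= /andP[zc cx] CE] := MVT zx (fun y _ => CG y).
    apply: derivable_within_continuous => y _.
    by have [] := CG y.
  have := G_monotone z c; rewrite Gz subr0 => h.
  have Gc : 0 < G c.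
    rewrite -(pmulr_lgt0 _ (_ : 0 < c - z)) ?subr_gt0//.
    by apply: lt_le_trans h; rewrite mulr_gt0// exprn_gt0// normr_gt0 subr_eq0 gt_eqF.
  by rewrite -subr_gt0 CE pmulr_lgt0 ?subr_gt0.
Qed.

End StronglyConvex.

Section Minimizers.
Context {R : realType} {N : nat} {Theta : finType} (J : 'I_N -> Theta -> R -> R).
Variables (mu L : R) (p : Theta -> R).
Hypotheses (N_gt0 : (0 < N)%N) (mu_gt0 : 0 < mu)
  (J_differentiable : forall i th z, derivable (J i th) z 1).
Hypothesis J_convex : forall i th x x',
  mu * `|x' - x| ^+ 2 <=
    (derive1 (J i th) x' - derive1 (J i th) x) * (x' - x) /\
  `|derive1 (J i th) x' - derive1 (J i th) x| <= L * `|x' - x|.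
Hypotheses (p_ge0 : forall th, 0 <= p th) (p_sum1 : \sum_th p th = 1).

Definition expected_gradient (i : 'I_N) (x : R) : R :=
  \sum_th p th * derive1 (J i th) x.

Lemma expected_gradient_monotone i u v : mu * `|v - u| ^+ 2 <=
  (expected_gradient i v - expected_gradient i u) * (v - u).
Proof.
rewrite -sumrB mulr_suml -[leLHS]mul1r -p_sum1 mulr_suml.
apply: ler_sum => th _; rewrite -mulrBr -mulrA ler_wpM2l//.
by have [] := J_convex i th u v.
Qed.

Lemma expected_gradient_lipschitz i u v :
  `|expected_gradient i v - expected_gradient i u| <= L * `|v - u|.
Proof.
rewrite -sumrB -[leRHS]mul1r -p_sum1 mulr_suml.
apply: le_trans (ler_norm_sum _ _ _) _.
apply: ler_sum => th _; rewrite -mulrBr normrM ger0_norm// ler_wpM2l//.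
by have [] := J_convex i th u v.
Qed.

Let G x := mean (fun i => expected_gradient i x).

Let is_derive_average_cost (x : R) : is_derive x 1 (average_cost J ^~ p) (G x).
Proof.
have JD i th : is_derive x 1 (J i th) (derive1 (J i th) x).
  by apply: DeriveDef => //; rewrite derive1E.
have ED i : is_derive x 1 (expected_cost J i ^~ p) (expected_gradient i x).
  by apply: is_derive_fsum => th; exact: (@is_deriveZ _ _ _ (J i th) (p th)).
apply: (@is_deriveZ _ _ _ (fun y => \sum_i expected_cost J i y p) N%:R^-1).
exact: is_derive_fsum.
Qed.

(** [xstar] is an arbitrary choice among the minimizers, so identifying it with the root of the
    averaged gradient requires existence and uniqueness together. *)
Lemma minimizers_root : exists z : R,
  [/\ mean (fun i => expected_gradient i z) = 0,
      minimizers J p = [set z] & xstar J p = z].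
Proof.
have GM u v : mu * `|v - u| ^+ 2 <= (G v - G u) * (v - u).
  rewrite -[leLHS](mean_cst _ N_gt0) meanB -mean_mulr.
  by apply: ler_mean => i; exact: expected_gradient_monotone.
have GL u v : `|G v - G u| <= L * `|v - u|.
  rewrite -[leRHS](mean_cst _ N_gt0) meanB; apply: le_trans (ler_norm_mean _) _.
  by apply: ler_mean => i; exact: expected_gradient_lipschitz.
have [z Gz] := strongly_monotone_root mu_gt0 GM GL.
have minz := strongly_convex_minimizer mu_gt0 is_derive_average_cost GM Gz.
have minE : minimizers J p = [set z].
  apply/seteqP; split => [x xmin|x ->] /=; last first.
    by move=> y; have [->//|/minz/ltW] := eqVneq y z.
  by apply: contrapT => /eqP /minz; rewrite ltNge (xmin z).
exists z; split => //; have : (minimizers J p) (xstar J p).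
  by apply: (@getPex _ (minimizers J p)); exists z; rewrite minE.
by rewrite minE.
Qed.

End Minimizers.

(** * Log-ratio form of the updates and convergence of the beliefs *)

Section Pooling.
Context {R : realType} {N : nat} {Theta : finType}.

Lemma sumr_gt0 (I : finType) (i0 : I) (F : I -> R) :
  (forall i, 0 < F i) -> 0 < \sum_i F i.
Proof.
by move=> F0; rewrite (bigD1 i0)//= ltr_wpDr// sumr_ge0// => i _; exact: ltW.
Qed.

Lemma log_pool_gt0 (W : 'M[R]_N) (b : 'I_N -> Theta -> R) i th :
  0 < log_pool W b i th.
Proof.
by rewrite divr_gt0 ?expR_gt0// (sumr_gt0 th)// => ?; exact: expR_gt0.
Qed.

Lemma sum_log_pool (th0 : Theta) (W : 'M[R]_N) (b : 'I_N -> Theta -> R) i :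
  \sum_th log_pool W b i th = 1.
Proof.
rewrite -mulr_suml divff// gt_eqF// (sumr_gt0 th0)// => ?; exact: expR_gt0.
Qed.

(** The normalising constants do not depend on the parameter and cancel in differences of
    logarithms; this makes pooling, and Bayes' rule below, affine in the log-ratios. *)
Lemma ln_log_pool_ratio (W : 'M[R]_N) (b : 'I_N -> Theta -> R) i th th' :
  ln (log_pool W b i th) - ln (log_pool W b i th') =
  \sum_j W i j * (ln (b j th) - ln (b j th')).
Proof.
have S0 : 0 < \sum_th' expR (\sum_j W i j * ln (b j th')).
  by rewrite (sumr_gt0 th)// => ?; exact: expR_gt0.
rewrite /log_pool !ln_div ?posrE ?expR_gt0// !expRK.
under [RHS]eq_bigr do rewrite mulrBr.
by rewrite sumrB; ring.
Qed.

Lemma ln_bayes_ratio (h q : Theta -> R) a th th' :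
  (forall s, 0 < h s) -> (forall s, 0 < q s) ->
  ln (bayes h a q th) - ln (bayes h a q th') =
  a * ln (h th / h th') + (ln (q th) - ln (q th')).
Proof.
move=> h0 q0.
have hq s : 0 < h s `^ a * q s by rewrite mulr_gt0// powR_gt0.
have S0 : 0 < \sum_s h s `^ a * q s by exact: (sumr_gt0 th).
rewrite /bayes !ln_div ?posrE// !lnM ?posrE ?powR_gt0// !ln_powR.
ring.
Qed.

End Pooling.

Section Beliefs.
Context {R : realType} {N : nat} {Theta : finType} (W : 'M[R]_N).
Variables (alpha : nat -> R) (h p : nat -> 'I_N -> Theta -> R).
Variables (thstar : Theta) (B : R).
Hypotheses (N_gt0 : (0 < N)%N) (W_stochastic : doubly_stochastic W).
Hypothesis W_radius : spectral_radius (consensus_residual W) < 1.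
Hypotheses (alpha_ge0 : forall t, 0 <= alpha t) (alpha_cvg0 : alpha @ \oo --> 0).
Hypothesis h_gt0 : forall t i th, 0 < h t i th.
Hypothesis h_bounded : forall t i th th', `|ln (h t i th / h t i th')| <= B.
Hypothesis p_init : forall i th, p 0 i th = #|Theta|%:R^-1.
Hypothesis p_step : forall t i th,
  p t.+1 i th = log_pool W (fun j => bayes (h t j) (alpha t) (p t j)) i th.

Lemma belief_gt0 t i th : 0 < p t i th.
Proof.
case: t => [|t]; last by rewrite p_step log_pool_gt0.
by rewrite p_init invr_gt0 ltr0n; apply/card_gt0P; exists th.
Qed.

Lemma sum_belief t i : \sum_th p t i th = 1.
Proof.
case: t => [|t].
  under eq_bigr do rewrite p_init.
  rewrite sumr_const -[_ *+ _]mulr_natl divff// pnatr_eq0 -lt0n.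
  by apply/card_gt0P; exists thstar.
by under eq_bigr do rewrite p_step; exact: (sum_log_pool thstar).
Qed.

Let lam t i th := ln (p t i th) - ln (p t i thstar).
Let ell t i th := ln (h t i th / h t i thstar).

Let lam_step t i th :
  lam t.+1 i th = \sum_j W i j * (lam t j th + alpha t * ell t j th).
Proof.
rewrite /lam !p_step ln_log_pool_ratio; apply: eq_bigr => j _.
by rewrite ln_bayes_ratio// => [|s]; [rewrite addrC|exact: belief_gt0].
Qed.

Let lam_mean t th : mean (fun i => lam t.+1 i th) =
  mean (fun i => lam t i th) + alpha t * mean (fun i => ell t i th).
Proof.
rewrite (_ : (fun i => lam t.+1 i th) = fun i =>
  \sum_j W i j * (lam t j th + alpha t * ell t j th)); last exact/funext.
by rewrite mean_doubly_stochastic// -meanD mean_mull.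
Qed.

Let exp_lam t i th : expR (lam t i th) = p t i th / p t i thstar.
Proof. by rewrite /lam expRB !lnK ?posrE ?belief_gt0. Qed.

Let lam_consensus i th :
  lam t i th - mean (fun j => lam t j th) @[t --> \oo] --> 0.
Proof.
apply: (@consensus_cvg _ _ W N_gt0 W_stochastic (fun t j => lam t j th)
  (fun t j => alpha t * ell t j th) W_radius) => [t j|{i} i].
  exact: lam_step.
apply/norm_cvg0P.
apply: (@squeeze_cvgr _ _ _ _ (fun=> 0) (fun t => alpha t * B)).
- by apply: nearW => t; rewrite normr_ge0/= normrM ger0_norm// ler_wpM2l// h_bounded.
- exact: cvg_cst.
- by rewrite -[X in _ --> X](mul0r B); apply: cvgM => //; exact: cvg_cst.
Qed.

(** A statement about one sample path: [k] stands for the conditional mean of the averaged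
    log-likelihood ratios. It enters through its sign and through the convergence of the compensated
    series. *)
Lemma belief_cvg (k : nat -> Theta -> R) :
  (forall t th, k t th <= 0) ->
  (forall th, cvgn (series (fun t =>
     alpha t * (mean (fun i => ln (h t i th / h t i thstar)) - k t th)))) ->
  exists qt : Theta -> R, [/\ limiting_belief thstar p qt,
    forall th, 0 <= qt th & \sum_th qt th = 1].
Proof.
move=> k0 kS.
pose lb th t := mean (fun i => lam t i th).
pose S th := series (fun t => alpha t * (mean (fun i => ell t i th) - k t th)).
(* lb - S changes by alpha k <= 0 and may tend to minus infinity, but its exponential is
   nonincreasing and bounded below by 0. *)
have lbS th : expR (lb th t - S th t) @[t --> \oo] -->
    inf (range (fun t => expR (lb th t - S th t))).
  apply: nonincreasing_cvgn; last by exists 0 => _ [t _ <-]; exact: expR_ge0.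
  apply/nonincreasing_seqP => t; rewrite ler_expR /lb lam_mean /S seriesSr.
  have : alpha t * k t th <= 0 by rewrite mulr_ge0_le0.
  lra.
pose nu th := limn (fun t => expR (lb th t)).
have lb_cvg th : expR (lb th t) @[t --> \oo] --> nu th.
  apply/cvg_ex; eexists.
  rewrite (_ : (fun t => _) = fun t => expR (lb th t - S th t) * expR (S th t)).
    apply: cvgM; first exact: lbS.
    apply: continuous_cvg; first exact: continuous_expR.
    exact: kS.
  by apply/funext => t; rewrite -expRD subrK.
have ratio_cvg i th : p t i th / p t i thstar @[t --> \oo] --> nu th.
  rewrite (_ : (fun t => _) = fun t => expR (lam t i th - lb th t) * expR (lb th t)).
    rewrite -[X in _ --> X]mul1r -expR0; apply: cvgM => //.
    apply: continuous_cvg; first exact: continuous_expR.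
    exact: lam_consensus.
  by apply/funext => t; rewrite -expRD subrK exp_lam.
have nu_ge0 th : 0 <= nu th.
  by apply: limr_ge; [apply/cvg_ex; eexists; exact: lb_cvg|apply: nearW => t; exact: expR_ge0].
have nu_star : nu thstar = 1.
  apply/cvg_lim => //.
  rewrite (_ : (fun t => _) = fun=> 1); first exact: cvg_cst.
  apply/funext => t; rewrite /lb /mean /lam.
  by under eq_bigr do rewrite subrr; rewrite big1// mulr0 expR0.
have nu_sum : 0 < \sum_th nu th.
  by rewrite (bigD1 thstar)//= nu_star ltr_wpDr// sumr_ge0.
exists (fun th => nu th / \sum_th' nu th'); split.
- exists nu; split => //.
  + move=> th; rewrite -[X in _ --> X](mean_cst (nu th) N_gt0).
    by apply: mean_cvg => i; exact: ratio_cvg.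
  (* Beliefs sum to 1, so normalising the ratios to [thstar] gives back the beliefs themselves. *)
  + move=> i th; rewrite (_ : (fun t => _) = fun t =>
      (p t i th / p t i thstar) / \sum_th' (p t i th' / p t i thstar)).
      apply: cvgM; first exact: ratio_cvg.
      apply: cvgV; first by rewrite gt_eqF.
      by apply: cvg_sum => th'; exact: ratio_cvg.
    apply/funext => t; rewrite -mulr_suml sum_belief mul1r invrK mulfVK//.
    by rewrite gt_eqF// belief_gt0.
- by move=> th; rewrite divr_ge0// ltW.
- by rewrite -mulr_suml divff// gt_eqF.
Qed.

End Beliefs.

(** * Almost sure convergence of orthogonal series with terms O(1/t) *)

(* Blocks [k^3, (k+1)^3) replace a maximal inequality: for terms O(1/t) the
   partial sums vary by O(1/k) inside a block, while orthogonality gives block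
   sums of variance O(1/k^4), small enough to be summable with weight k^2. *)
Section CubeBlocks.
Context {R : realType}.

Lemma sum_inv_sqr_le2 n : \sum_(0 <= k < n) (k.+1%:R ^- 2 : R) <= 2.
Proof.
case: n => [|n]; first by rewrite big_geq.
suff : \sum_(0 <= k < n.+1) (k.+1%:R ^- 2 : R) <= 2 - n.+1%:R^-1.
  by move/le_trans; apply; rewrite gerBl.
elim: n => [|n IH]; first by rewrite big_nat1 expr1n invr1; lra.
rewrite big_nat_recr//=; apply: le_trans (lerD IH (lexx _)) _.
rewrite -subr_ge0.
have -> : 2 - n.+2%:R^-1 - (2 - n.+1%:R^-1 + n.+2%:R ^- 2) =
   (n.+1%:R * n.+2%:R ^+ 2)^-1 :> R; last by rewrite invr_ge0 mulr_ge0.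
rewrite -[n.+2%:R]natr1; field.
by rewrite nat1r natr1 !pnatr_eq0.
Qed.

Lemma cube_block n : exists k : nat, (k ^ 3 <= n < k.+1 ^ 3)%N.
Proof.
elim: n => [|n [k /andP[h1 h2]]]; first by exists 0%N.
have [h3|h3] := ltnP n.+1 (k.+1 ^ 3).
  by exists k; rewrite h3 andbT; exact: leq_trans h1 _.
exists k.+1; rewrite h3/=; apply: leq_ltn_trans h2 _.
by rewrite ltn_exp2r.
Qed.

Lemma cube_block_size k : (k.+1 ^ 3 - k ^ 3 <= 3 * k.+1 ^ 2)%N.
Proof. by rewrite !expnS !expn0 !muln1; nia. Qed.

(** The constant 4 is sharp: equality holds at k = 1. *)
Lemma cube_succ_le k : (k.+1 ^ 3 <= 4 * (k ^ 3).+1)%N.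
Proof.
have := leq0n k; rewrite !expnS !expn0 !muln1.
case: k => [|[|[|k]]] // _; nia.
Qed.

Lemma cube_block_inv k t : (k ^ 3 <= t)%N -> (t.+1%:R^-1 : R) <= 4 / k.+1%:R ^+ 3.
Proof.
move=> kt; rewrite -[leLHS]div1r ler_pdivrMr// mulrAC ler_pdivlMr ?exprn_gt0// mul1r.
rewrite -natrX -natrM ler_nat; apply: leq_trans (cube_succ_le k) _.
by rewrite leq_mul2l.
Qed.

Definition block_sum (u : nat -> R) k := \sum_(k ^ 3 <= t < k.+1 ^ 3) u t.

Lemma cvg_series_blocks (u : nat -> R) (C M : R) :
  (forall t, `|u t| <= C / t.+1%:R) ->
  (forall n, \sum_(0 <= k < n) k.+1%:R ^+ 2 * block_sum u k ^+ 2 <= M) ->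
  cvgn (series u).
Proof.
move=> uC uM.
have C0 : 0 <= C.
  by have := uC 0%N; rewrite divr1; apply: le_trans.
have serE n : series u (n ^ 3)%N = \sum_(0 <= k < n) block_sum u k.
  elim: n => [|n IH]; first by rewrite /series/= !big_geq.
  rewrite big_nat_recr//= -IH /series/= /block_sum [LHS](@big_cat_nat _ _ _ (n ^ 3)%N)//=.
  by rewrite leq_exp2r.
(* Completing the square with weight s = (k+1)^2 gives |b| <= 1/s + s b^2, and both terms have
   bounded partial sums. *)
have absb k : `|block_sum u k| <= k.+1%:R ^- 2 + k.+1%:R ^+ 2 * block_sum u k ^+ 2.
  set b := block_sum u k; rewrite -(real_normK (num_real b)); set a := `|b|.
  set s : R := k.+1%:R ^+ 2.
  have s0 : 0 < s by rewrite exprn_gt0.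
  have -> : s^-1 + s * a ^+ 2 = a + s * ((a - s^-1 / 2) ^+ 2 + 3 / 4 * s^-1 ^+ 2).
    by field; rewrite gt_eqF.
  by rewrite lerDl mulr_ge0 ?(ltW s0)// addr_ge0 ?sqr_ge0// mulr_ge0 ?sqr_ge0.
have : cvgn (series (fun k => block_sum u k)).
  apply: normed_cvg; apply: nondecreasing_is_cvgn.
    by apply/nondecreasing_series => k _ _; exact: normr_ge0.
  exists (2 + M) => _ [n _ <-]; rewrite /series/=.
  apply: (@le_trans _ _ (\sum_(0 <= k < n)
     (k.+1%:R ^- 2 + k.+1%:R ^+ 2 * block_sum u k ^+ 2))).
    exact: ler_sum.
  by rewrite big_split/= lerD ?sum_inv_sqr_le2.
move=> /cvg_ex[l ul]; apply/cvg_ex; exists l.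
apply/cvgrPdist_le => e e0; have e2 : 0 < e / 2 by rewrite divr_gt0.
move/cvgrPdist_le : ul => /(_ _ e2)[K1 _ K1P].
(* 12 = 3 * 4: a block has at most 3 (k+1)^2 terms, each at most 4 C / (k+1)^3. *)
have [K2 _ K2P] : \forall k \near \oo, 12 * C / k.+1%:R <= e / 2.
  have h : 12 * C / k.+1%:R @[k --> \oo] --> (0 : R).
    rewrite -[X in _ --> X](mulr0 (12 * C)); apply: cvgM; first exact: cvg_cst.
    exact: cvg_harmonic.
  by apply: filterS (cvgr_lt _ h _ e2) => k /ltW.
exists ((maxn K1 K2) ^ 3)%N => // n /= Kn.
have [k /andP[kn nk]] := cube_block n.
have Kk : (maxn K1 K2 <= k)%N by rewrite -ltnS -(ltn_exp2r _ _ (isT : 0 < 3)%N); exact: leq_ltn_trans nk.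
have -> : l - series u n = (l - series u (k ^ 3)%N) - (series u n - series u (k ^ 3)%N) by ring.
apply: le_trans (ler_normB _ _) _; rewrite [leRHS]splitr; apply: lerD.
  by rewrite serE; apply: K1P => /=; lia.
apply: le_trans (K2P k _); last by rewrite /=; lia.
rewrite sub_series_geq//; apply: le_trans (ler_norm_sum _ _ _) _.
apply: (@le_trans _ _ (\sum_(k ^ 3 <= t < n) (C * (4 / k.+1%:R ^+ 3)))).
  rewrite big_nat_cond [leRHS]big_nat_cond; apply: ler_sum => t /andP[/andP[kt _] _].
  by apply: le_trans (uC t) _; rewrite ler_wpM2l// cube_block_inv.
rewrite sumr_const_nat -[_ *+ _]mulr_natl.
apply: (@le_trans _ _ ((3 * k.+1 ^ 2)%N%:R * (C * (4 / k.+1%:R ^+ 3)))).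
  rewrite ler_wpM2r ?mulr_ge0 ?divr_ge0// ler_nat.
  apply: leq_trans (cube_block_size k); rewrite leq_sub2r// ltnW//.
rewrite natrM natrX le_eqVlt; apply/orP; left; apply/eqP.
by field; rewrite nat1r pnatr_eq0.
Qed.

End CubeBlocks.

Section OrthogonalSeries.
Context {R : realType} {d : measure_display} {T : measurableType d}.
Variable P : probability T R.

Lemma bounded_integrable (f : T -> R) (K : R) :
  measurable_fun setT f -> (forall w, `|f w| <= K) -> P.-integrable setT (EFin \o f).
Proof.
move=> mf fK; apply: measurable_bounded_integrable => //.
  by apply: le_lt_trans (probability_le1 P measurableT) _; exact: ltry.
exists K; split; first exact: num_real.
by move=> x Kx w _; apply: le_trans (fK w) _; exact: ltW.
Qed.

Lemma ae_cvg_orthogonal_series (D : nat -> T -> R) (C : R) :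
  (forall t, measurable_fun setT (D t)) ->
  (forall t w, `|D t w| <= C / t.+1%:R) ->
  (forall s t, (s < t)%N -> (\int[P]_w (D s w * D t w)%:E = 0)%E) ->
  {ae P, forall w, cvgn (series (fun t => D t w))}.
Proof.
move=> mD DC D0.
have C0 : 0 <= C by have := DC 0%N point; rewrite divr1; apply: le_trans.
have C0' t : 0 <= C / t.+1%:R by rewrite divr_ge0.
have DDK s t w : `|D s w * D t w| <= (C / s.+1%:R) * (C / t.+1%:R).
  by rewrite normrM ler_pM.
have iDD s t : P.-integrable setT (fun w => (D s w * D t w)%:E).
  by apply: bounded_integrable (DDK s t); exact: measurable_funM.
have DD s t : (\int[P]_w (D s w * D t w)%:E <= (if s == t then (C / s.+1%:R) ^+ 2 else 0)%:E)%E.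
  case: (ltngtP s t) => [st|ts|<-].
  - by rewrite D0.
  - by under eq_integral do rewrite mulrC; rewrite D0.
  - rewrite -[leRHS]mule1 -(probability_setT P) -integral_cst//.
    apply: ge0_le_integral => //.
    + by move=> w _; rewrite lee_fin -expr2 sqr_ge0.
    + by apply/measurable_EFinP; exact: measurable_funM.
    + by move=> w _; rewrite lee_fin; apply: le_trans (ler_norm _) (DDK s s w).
pose b k w := block_sum (D ^~ w) k.
have mb k : measurable_fun setT (b k) by exact: measurable_sum.
pose F k w := (k.+1%:R ^+ 2 * b k w ^+ 2)%:E.
have mF k : measurable_fun setT (F k).
  by apply/measurable_EFinP/measurable_funM => //; exact: measurable_funX.
have F0 k w : (0 <= F k w)%E by rewrite lee_fin mulr_ge0 ?sqr_ge0.
(* 48 = 3 * 4^2: only the diagonal survives, with at most 3 (k+1)^2 terms bounded by (4 C /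
   (k+1)^3)^2, and the weight is (k+1)^2. *)
have IF k : (\int[P]_w F k w <= (48 * C ^+ 2 * k.+1%:R ^- 2)%:E)%E.
  rewrite (_ : (fun w => F k w) = fun w => ((k.+1%:R ^+ 2)%:E *
    \sum_(k ^ 3 <= s < k.+1 ^ 3) \sum_(k ^ 3 <= t < k.+1 ^ 3) (D s w * D t w)%:E)%E); last first.
    apply/funext => w; rewrite /F EFinM; congr (_ * _)%E.
    under eq_bigr do rewrite sumEFin.
    rewrite sumEFin expr2 /b /block_sum mulr_suml; congr EFin.
    by apply: eq_bigr => s _; rewrite mulr_sumr.
  rewrite integralZl//; last first.
    by apply: integrable_sum => // s _; exact: integrable_sum.
  rewrite integral_sum//; last by move=> s; exact: integrable_sum.
  have -> : 48 * C ^+ 2 * k.+1%:R ^- 2 =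
      k.+1%:R ^+ 2 * ((3 * k.+1%:R ^+ 2) * (C * (4 / k.+1%:R ^+ 3)) ^+ 2).
    by field; rewrite nat1r pnatr_eq0.
  rewrite [leRHS]EFinM lee_wpmul2l// ?lee_fin ?sqr_ge0//.
  apply: (@le_trans _ _ (\sum_(k ^ 3 <= s < k.+1 ^ 3) ((C * (4 / k.+1%:R ^+ 3)) ^+ 2)%:E)%E).
    rewrite big_nat_cond [leRHS]big_nat_cond; apply: lee_sum => s /andP[/andP[ks sk] _].
    rewrite integral_sum//.
    apply: (@le_trans _ _ (\sum_(k ^ 3 <= t < k.+1 ^ 3) (if s == t then (C / s.+1%:R) ^+ 2 else 0)%:E)%E).
      by apply: lee_sum => t _; exact: DD.
    rewrite sumEFin lee_fin (bigD1_seq s) ?iota_uniq ?mem_index_iota ?ks//= eqxx.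
    rewrite big1 => [|t /negPf ts]; last by rewrite eq_sym ts.
    rewrite addr0 ler_sqr ?nnegrE ?mulr_ge0 ?divr_ge0// ler_wpM2l//.
    exact: cube_block_inv.
  rewrite sumEFin lee_fin sumr_const_nat -[_ *+ _]mulr_natl ler_wpM2r ?sqr_ge0//.
  by rewrite -natrX -natrM ler_nat cube_block_size.
(* The weighted squares have a finite expected sum, so their sum is finite on almost every path,
   where it serves as the path-dependent bound [M] of the block criterion. *)
pose S w := (\sum_(0 <= k <oo) F k w)%E.
have mS : measurable_fun setT S.
  by apply: ge0_emeasurable_sum => // k w _ _; exact: F0.
have iS : P.-integrable setT S.
  apply/integrableP; split => //.
  under eq_integral do rewrite gee0_abs ?nneseries_ge0//.
  rewrite integral_nneseries//.
  apply: (@le_lt_trans _ _ (48 * C ^+ 2 * 2)%:E); last exact: ltry.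
  apply: lime_le.
    by apply: is_cvg_nneseries => k _ _; exact: integral_ge0.
  apply: nearW => n.
  apply: (@le_trans _ _ (\sum_(0 <= k < n) (48 * C ^+ 2 * k.+1%:R ^- 2)%:E)%E).
    by apply: lee_sum => k _; exact: IF.
  rewrite sumEFin lee_fin -mulr_sumr ler_wpM2l ?mulr_ge0 ?sqr_ge0//.
  exact: sum_inv_sqr_le2.
have := integrable_ae measurableT iS; apply: filterS => w /(_ I) Sfin.
apply: (@cvg_series_blocks _ _ C (fine (S w))) => [t|n]; first exact: DC.
rewrite -lee_fin fineK// -sumEFin.
by apply: (@nneseries_lim_ge _ (F ^~ w)) => k _ _; exact: F0.
Qed.

End OrthogonalSeries.

(** * Measures with densities and conditional densities *)

Section Density.
Context {R : realType} {d : measure_display} {T : measurableType d}.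
Import HBNNSimple.
Local Open Scope ereal_scope.

Lemma density_measure (mu : {measure set T -> \bar R}) (g : T -> R) :
  measurable_fun setT g -> (forall u, (0 <= g u)%R) ->
  exists m : {measure set T -> \bar R}, forall C, m C = \int[mu]_(u in C) (g u)%:E.
Proof.
move=> mg g0; pose m (C : set T) := \int[mu]_(u in C) (g u)%:E.
have m0 : m set0 = 0 by rewrite /m integral_set0.
have mge0 C : 0 <= m C by apply: integral_ge0 => u _; rewrite lee_fin.
have msig : semi_sigma_additive m.
  move=> /= F mF tF mUF; rewrite /m; apply: cvg_toP.
    apply: ereal_nondecreasing_is_cvgn => k n kn.
    by apply: lee_sum_nneg_natr => // i _ _; exact: mge0.
  rewrite ge0_integral_bigcup//=; last by move=> u _; rewrite lee_fin.
  by apply: measurable_funTS; exact/measurable_EFinP.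
pose M : {measure set T -> \bar R} :=
  HB.pack m (isMeasure.Build _ _ _ m m0 mge0 msig).
by exists M.
Qed.

(** By monotone convergence along the same simple functions on both sides, the claim reduces to
    their level sets, where it is the hypothesis on [nu]. *)
Lemma integral_density (nu mu : {measure set T -> \bar R}) (f : T -> \bar R)
    (g : T -> R) :
  measurable_fun setT g -> (forall u, (0 <= g u)%R) ->
  (forall C, measurable C -> nu C = \int[mu]_(u in C) (g u)%:E) ->
  measurable_fun setT f -> (forall u, 0 <= f u) ->
  \int[nu]_u f u = \int[mu]_u (f u * (g u)%:E).
Proof.
move=> mg g0 nuE mf f0.
have mE := @measurableT _ T.
pose h := nnsfun_approx mE mf.
have -> : \int[nu]_u f u = lim (\int[nu]_u (EFin \o h n) u @[n --> \oo]).
  have fE u : f u = lim ((EFin \o h n) u @[n --> \oo]).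
    by apply/esym/cvg_lim => //; exact: cvg_nnsfun_approx.
  under eq_integral => u _ do rewrite fE.
  apply: monotone_convergence => //.
  - by move=> n; apply/measurable_EFinP; exact/measurable_funP.
  - by move=> n x _ //=; rewrite lee_fin.
  - by move=> x _ a b ab; rewrite lee_fin; exact/lefP/nd_nnsfun_approx.
have -> : \int[mu]_u (f u * (g u)%:E) =
    lim (\int[mu]_u ((h n u)%:E * (g u)%:E) @[n --> \oo]).
  have fg u : f u * (g u)%:E = lim (((h n u)%:E * (g u)%:E) @[n --> \oo]).
    apply/esym/cvg_lim => //.
    by apply: cvgeZr => //; exact: cvg_nnsfun_approx.
  under eq_integral => u _ do rewrite fg.
  apply: monotone_convergence => //.
  - by move=> n; apply: emeasurable_funM; exact/measurable_EFinP.
  - by move=> n x _; rewrite mule_ge0 ?lee_fin.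
  - move=> x _ a b ab /=; rewrite lee_wpmul2r ?lee_fin//.
    exact/lefP/nd_nnsfun_approx.
suff suf n : \int[nu]_u (h n u)%:E = \int[mu]_u ((h n u)%:E * (g u)%:E).
  by under eq_fun do rewrite suf.
transitivity (\int[nu]_u
   (\sum_(y \in range (h n)) (y * \1_(h n @^-1` [set y]) u)%:E)).
  by apply: eq_integral => t _; rewrite /= fimfunE -fsumEFin.
rewrite ge0_integral_fsum//; last 2 first.
- by move=> y; apply/measurable_EFinP; exact: measurable_funM.
- by move=> y u _; exact: nnfun_muleindic_ge0.
transitivity (\int[mu]_u (\sum_(y \in range (h n))
    ((y * \1_(h n @^-1` [set y]) u)%:E * (g u)%:E))); last first.
  apply: eq_integral => u _.
  rewrite -ge0_mule_fsuml => [|y]; last exact: nnfun_muleindic_ge0.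
  by rewrite fsumEFin// -(fimfunE _ u).
rewrite ge0_integral_fsum//; last 2 first.
- move=> y; apply: emeasurable_funM; apply/measurable_EFinP => //.
  exact: measurable_funM.
- by move=> y u _; apply: mule_ge0; [exact: nnfun_muleindic_ge0|rewrite lee_fin].
apply: eq_fsbigr => r _.
under [LHS]eq_integral do rewrite EFinM.
rewrite integralZl_indic_nnsfun// integral_indic// setIT nuE//.
under [RHS]eq_integral do rewrite EFinM -muleA.
(* A negative value has an empty level set, since the approximants are nonnegative; otherwise the
   scalar can be pulled out of the integral. *)
have [r0|r0] := leP 0%R r; last first.
  have -> : h n @^-1` [set r] = set0.
    by rewrite -subset0 => u /= hu; move: r0; rewrite -hu ltNge fun_ge0.
  rewrite integral_set0 mule0 integral0_eq// => u _.
  by rewrite indicE in_set0 mul0e mule0.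
rewrite ge0_integralZl//; last 2 first.
- by apply: emeasurable_funM; apply/measurable_EFinP.
- by move=> u _; rewrite mule_ge0 ?lee_fin.
congr (_ * _); rewrite integral_mkcond; apply: eq_integral => u _.
by rewrite epatch_indic muleC.
Qed.

End Density.

Section ConditionalDensity.
Context {R : realType} {d d' : measure_display}.
Context {T : measurableType d} {T' : measurableType d'}.
Variables (P : probability T R) (p : {mfun T >-> T'}).
Variables (X : T' -> R) (Y : T -> R) (h : R -> R -> R).
Hypotheses (mX : measurable_fun setT X) (mY : measurable_fun setT Y).
Hypothesis mh : measurable_fun setT (fun u : R * R => h u.1 u.2).
Hypothesis h0 : forall x z, 0 <= h x z.
Local Open Scope ereal_scope.
Hypothesis condP : forall (E : set T') (A : set R), measurable E -> measurable A ->
  P (p @^-1` E `&` Y @^-1` A) =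
  \int[P]_(w in p @^-1` E) \int[lebesgue_measure]_(z in A) (h (X (p w)) z)%:E.

(* lebesgue_measure lives on measurableTypeR R, whose display differs from the one
   of R: product types must use the former to be integrated against it. *)
Let g (u : T' * measurableTypeR R) : R := h (X u.1) u.2.

Let mg : measurable_fun setT g.
Proof.
have mh' : measurable_fun setT (fun u : R * measurableTypeR R => h u.1 u.2) := mh.
rewrite (_ : g = (fun u => h u.1 u.2) \o
  (fun u : T' * measurableTypeR R => (X u.1, u.2) : R * measurableTypeR R))//.
apply: measurableT_comp mh' _.
apply: measurable_fun_pair; last exact: measurable_snd.
by apply: measurableT_comp => //; exact: measurable_fst.
Qed.

Let mpY : measurable_fun setT (fun w => (p w, Y w) : T' * measurableTypeR R).
Proof. by apply: measurable_fun_pair => //; exact: mY. Qed.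

Let pY : {mfun T >-> (T' * measurableTypeR R)%type} :=
  HB.pack (fun w => (p w, Y w) : T' * measurableTypeR R) (isMeasurableFun.Build _ _ _ _ _ mpY).

Let mu := distribution P p \x (@lebesgue_measure R).

(** In the application [p] is the identity into the sample space equipped with the past, and [condP]
    is the conditional density hypothesis. By Tonelli it prescribes the joint law on rectangles;
    these form a pi-system generating the product sigma-algebra, and the law is finite, so
    uniqueness of measures applies. *)
Lemma joint_law (C : set (T' * measurableTypeR R)) : measurable C ->
  distribution P pY C = \int[mu]_(u in C) (g u)%:E.
Proof.
have g0 u : (0 <= g u)%R by exact: h0.
have [m mE] := density_measure mu mg g0.
move=> mC; rewrite -mE; move: C mC.
move=> C mC; apply: (@measure_unique _ _ _
  [set A `*` B | A in measurable & B in measurable] (fun=> setT) _ _ _ _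
  (distribution P pY) m _ _ _ mC).
- exact: measurable_prod_measurableType.
- move=> _ _ [A1 mA1 [B1 mB1 <-]] [A2 mA2 [B2 mB2 <-]].
  rewrite -setXI; exists (A1 `&` A2); first exact: measurableI.
  by exists (B1 `&` B2) => //; exact: measurableI.
- by move=> _; exists setT => //; exists setT => //; rewrite setXTT.
- by rewrite bigcup_const//; exists 0%N.
- move=> _ [A mA [B mB <-]]; rewrite mE.
  have mgr : measurable_fun setT ((fun u => (g u)%:E) \_ (A `*` B)).
    apply: (measurable_restrictT _ (measurableX mA mB)).1.
    by apply: measurable_funTS; exact/measurable_EFinP.
  have gr0 u : 0 <= ((fun u => (g u)%:E) \_ (A `*` B)) u.
    by rewrite erestrict_ge0// => v _; rewrite lee_fin.
  rewrite -[LHS]/(P (p @^-1` A `&` Y @^-1` B)) condP// [RHS]integral_mkcond.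
  rewrite [RHS]fubini_tonelli1// [RHS]ge0_integral_distribution; last 2 first.
  + exact: measurable_fun_fubini_tonelli_F.
  + by move=> u; exact: integral_ge0.
  rewrite [LHS]integral_mkcond; apply: eq_integral => w _.
  rewrite [LHS]patchE /= /fubini_F; case: ifPn => wA.
    rewrite [LHS]integral_mkcond; apply: eq_integral => z _.
    have {}wA : p w \in A by move: wA; rewrite !inE.
    by rewrite !patchE in_setX/= wA.
  have {}wA : p w \notin A by apply: contra wA; rewrite !inE.
  by rewrite integral0_eq// => z _; rewrite patchE in_setX/= (negbTE wA).
- by move=> _; apply: le_lt_trans (probability_le1 _ measurableT) (ltry _).
Qed.

(** [condP] tests rectangles only, whereas an innovation depends jointly on a past decision and on
    the new observation; this disintegration formula bridges the gap. *)
Lemma conditional_density_integral (F : T' * measurableTypeR R -> \bar R) :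
  measurable_fun setT F -> (forall u, 0 <= F u) ->
  \int[P]_w F (p w, Y w) =
  \int[P]_w \int[lebesgue_measure]_z (F (p w, z) * (h (X (p w)) z)%:E).
Proof.
move=> mF F0.
have mFg : measurable_fun setT (fun u => F u * (g u)%:E).
  by apply: emeasurable_funM => //; exact/measurable_EFinP.
have Fg0 u : 0 <= F u * (g u)%:E by apply: mule_ge0 => //; rewrite lee_fin; exact: h0.
transitivity (\int[distribution P pY]_u F u); first exact/esym/ge0_integral_distribution.
rewrite (@integral_density _ _ _ (distribution P pY) mu F g)//; last 2 first.
- by move=> u; exact: h0.
- exact: joint_law.
rewrite fubini_tonelli1// ge0_integral_distribution//.
  exact: measurable_fun_fubini_tonelli_F.
by move=> u; exact: integral_ge0.
Qed.

End ConditionalDensity.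

(** * Innovations are orthogonal to the past *)

Section Innovation.
Context {R : realType}.
Variables (h phi : R -> R -> R) (M : R).
Hypothesis mh : measurable_fun setT (fun u : R * R => h u.1 u.2).
Hypothesis mphi : measurable_fun setT (fun u : R * R => phi u.1 u.2).
Hypothesis h0 : forall x z, 0 <= h x z.
Hypothesis h1 : forall x, (\int[lebesgue_measure]_z (h x z)%:E = 1)%E.
Hypothesis phi_bounded : forall x z, 0 <= phi x z <= M.

(** [fine] loses nothing: 0 <= phi <= M and unit mass put the integral in [0, M]. Nonnegativity of
    [phi] also makes Tonelli applicable throughout. *)
Definition conditional_mean (x : R) : R :=
  fine (\int[lebesgue_measure]_z (phi x z * h x z)%:E).

Let M0 : 0 <= M.
Proof. by have /andP[/le_trans h2 /h2] := phi_bounded 0 0. Qed.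

Let section2 (g : R -> R -> R) x :
  measurable_fun setT (fun u : R * R => g u.1 u.2) ->
  measurable_fun (setT : set (measurableTypeR R)) (g x).
Proof.
move=> mg; have m1 : measurable_fun setT (fun u : R * measurableTypeR R => g u.1 u.2) := mg.
rewrite (_ : g x = (fun u => g u.1 u.2) \o (pair x : measurableTypeR R -> R * measurableTypeR R))//.
by apply: (measurableT_comp m1); exact: pair1_measurable.
Qed.

Let mphih : measurable_fun setT (fun u : R * R => (phi u.1 u.2 * h u.1 u.2)).
Proof. exact: measurable_funM. Qed.

Let phih0 x z : 0 <= phi x z * h x z.
Proof. by rewrite mulr_ge0//; have /andP[] := phi_bounded x z. Qed.

Lemma integral_conditional_mean_le x :
  (\int[lebesgue_measure]_z (phi x z * h x z)%:E <= M%:E)%E.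
Proof.
apply: (@le_trans _ _ (\int[lebesgue_measure]_z (M%:E * (h x z)%:E))%E).
  apply: ge0_le_integral => //.
  - by move=> z _; rewrite lee_fin.
  - by apply/measurable_EFinP; exact: (@section2 (fun x z => phi x z * h x z) _ mphih).
  - by apply: measurable_funeM; apply/measurable_EFinP; exact: section2.
  - by move=> z _; rewrite -EFinM lee_fin ler_wpM2r//; have /andP[] := phi_bounded x z.
rewrite ge0_integralZl//.
- by rewrite h1 mule1.
- by apply/measurable_EFinP; exact: section2.
- by move=> z _; rewrite lee_fin.
Qed.

Lemma conditional_meanE x :
  (\int[lebesgue_measure]_z (phi x z * h x z)%:E = (conditional_mean x)%:E)%E.
Proof.
rewrite fineK// ge0_fin_numE; first exact: le_lt_trans (integral_conditional_mean_le x) (ltry _).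
by apply: integral_ge0 => z _; rewrite lee_fin.
Qed.

Lemma conditional_mean_bounded x : 0 <= conditional_mean x <= M.
Proof.
rewrite -!lee_fin -conditional_meanE integral_conditional_mean_le andbT.
by apply: integral_ge0 => z _; rewrite lee_fin.
Qed.

Lemma measurable_conditional_mean : measurable_fun setT conditional_mean.
Proof.
apply: measurableT_comp; first exact: fine_measurable.
apply: (@measurable_fun_fubini_tonelli_F _ _ R (measurableTypeR R) R lebesgue_measure
  (fun u => (phi u.1 u.2 * h u.1 u.2)%:E)).
  by apply/measurable_EFinP; exact: mphih.
by move=> u; rewrite lee_fin.
Qed.

Context {d d' : measure_display} {T : measurableType d} {T' : measurableType d'}.
Variables (P : probability T R) (p : {mfun T >-> T'}).
Variables (X : T' -> R) (Y : T -> R).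
Hypotheses (mX : measurable_fun setT X) (mY : measurable_fun setT Y).
Hypothesis condP : forall (E : set T') (A : set R), measurable E -> measurable A ->
  (P (p @^-1` E `&` Y @^-1` A) =
  \int[P]_(w in p @^-1` E) \int[lebesgue_measure]_(z in A) (h (X (p w)) z)%:E)%E.

Let mphiXY : measurable_fun setT (fun w => phi (X (p w)) (Y w)).
Proof.
apply: (@measurableT_comp _ _ _ _ _ _ (fun u : R * R => phi u.1 u.2) _
  (fun w => (X (p w), Y w))) => //.
by apply: measurable_fun_pair => //; exact: measurableT_comp.
Qed.

Let mkX : measurable_fun setT (fun w => conditional_mean (X (p w))).
Proof.
apply: (measurableT_comp measurable_conditional_mean).
exact: measurableT_comp.
Qed.

Let ge0_innovation (Z : T' -> R) : measurable_fun setT Z -> (forall u, 0 <= Z u) ->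
  (\int[P]_w (Z (p w) * phi (X (p w)) (Y w))%:E =
   \int[P]_w (Z (p w) * conditional_mean (X (p w)))%:E)%E.
Proof.
move=> mZ Z0.
have mphi' : measurable_fun setT (fun u : R * measurableTypeR R => phi u.1 u.2) := mphi.
rewrite (conditional_density_integral mX mY mh h0 condP
  (F := fun u => (Z u.1 * phi (X u.1) u.2)%:E)).
- apply: eq_integral => w _ /=.
  rewrite [RHS]EFinM -conditional_meanE -ge0_integralZl//.
  + by apply: eq_integral => z _; rewrite -!EFinM mulrA.
  + by apply/measurable_EFinP; exact: (@section2 (fun x z => phi x z * h x z) _ mphih).
  + by move=> z _; rewrite lee_fin.
  + by rewrite lee_fin.
- apply/measurable_EFinP/measurable_funM.
    by apply: measurableT_comp => //; exact: measurable_fst.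
  apply: (measurableT_comp mphi' (g := fun u => (X u.1, u.2))).
  apply: measurable_fun_pair; last exact: measurable_snd.
  by apply: measurableT_comp => //; exact: measurable_fst.
- by move=> u; rewrite lee_fin mulr_ge0//; have /andP[] := phi_bounded (X u.1) u.2.
Qed.

(** For a nonnegative weight this is disintegration. A signed bounded [Z] is written as (Z + K) - K,
    a difference of two nonnegative bounded weights. *)
Lemma innovation_orthogonal (Z : T' -> R) (K : R) :
  measurable_fun setT Z -> (forall u, `|Z u| <= K) ->
  (\int[P]_w (Z (p w) * (phi (X (p w)) (Y w) - conditional_mean (X (p w))))%:E = 0)%E.
Proof.
move=> mZ ZK.
have K0 : 0 <= K by apply: le_trans (ZK point).
have iZ (V : T' -> R) (g : T -> R) L : measurable_fun setT V -> (forall u, `|V u| <= L) ->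
    measurable_fun setT g -> (forall w, 0 <= g w <= M) ->
    P.-integrable setT (fun w => (V (p w) * g w)%:E).
  move=> mV VL mg gM; apply: (@bounded_integrable _ _ _ _ _ (L * M)).
    by apply: measurable_funM => //; exact: measurableT_comp.
  move=> w; rewrite normrM ler_pM//; have /andP[g0 gM'] := gM w.
  by rewrite ger0_norm.
have phiM w : 0 <= phi (X (p w)) (Y w) <= M by [].
have kM w : 0 <= conditional_mean (X (p w)) <= M by exact: conditional_mean_bounded.
have V0 (V : T' -> R) L : measurable_fun setT V -> (forall u, 0 <= V u <= L) ->
    (\int[P]_w (V (p w) * (phi (X (p w)) (Y w) - conditional_mean (X (p w))))%:E = 0)%E.
  move=> mV VL.
  have VL' u : `|V u| <= L by have /andP[V0 VL2] := VL u; rewrite ger0_norm.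
  under eq_integral do rewrite mulrBr EFinB.
  rewrite integralB//; [|exact: iZ VL' _ _|exact: iZ VL' _ _].
  rewrite ge0_innovation// ?subee//; last by move=> u; have /andP[] := VL u.
  exact: integrable_fin_num (iZ _ _ _ mV VL' mkX kM).
transitivity (\int[P]_w
  (((Z (p w) + K) * (phi (X (p w)) (Y w) - conditional_mean (X (p w))))%:E -
   (cst K (p w) * (phi (X (p w)) (Y w) - conditional_mean (X (p w))))%:E))%E.
  by apply: eq_integral => w _; rewrite -EFinB mulrDl addrK.
have mZK : measurable_fun setT (fun u => Z u + K) by exact: measurable_funD.
have ZKb u : 0 <= Z u + K <= K + K.
  by have := ZK u; rewrite ler_norml => /andP[? ?]; apply/andP; split; lra.
have ipsi (V : T' -> R) L : measurable_fun setT V -> (forall u, 0 <= V u <= L) ->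
   P.-integrable setT (fun w => (V (p w) * (phi (X (p w)) (Y w) - conditional_mean (X (p w))))%:E).
  move=> mV VL.
  have VL' u : `|V u| <= L by have /andP[V0' VL2] := VL u; rewrite ger0_norm.
  under eq_fun do rewrite mulrBr EFinB.
  by apply: integrableB => //; exact: iZ VL' _ _.
rewrite integralB//; [|exact: ipsi ZKb|apply: (ipsi _ K) => // u; rewrite K0 lexx//].
have -> := V0 _ _ mZK ZKb.
have Kb (u : T') : 0 <= cst K u <= K by rewrite K0 lexx.
by have -> := V0 _ _ (measurable_cst K) Kb; rewrite sube0.
Qed.

End Innovation.

(** * Likelihoods: joint measurability and the sign of the mean log-ratio *)

(** Rounding the first argument down to a grid of mesh 1/(n+1) yields functions whose preimages are
    countable unions of measurable rectangles; continuity in that argument makes them converge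
    pointwise to [f]. *)
Lemma caratheodory_measurable (R : realType) (f : R -> R -> R) :
  (forall x, measurable_fun setT (f x)) -> (forall y, continuous (f ^~ y)) ->
  measurable_fun setT (fun u : R * R => f u.1 u.2).
Proof.
move=> mf cf.
pose r n (x : R) : R := (Num.floor (n.+1%:R * x))%:~R / n.+1%:R.
apply: (@measurable_fun_cvg _ _ _ _ (fun n u => f (r n u.1) u.2)); last first.
  move=> -[x y] _ /=; apply: (@cvg_comp _ _ _ (r ^~ x) (f ^~ y) _ (nbhs x)); last exact: cf.
  apply/subr_cvg0/norm_cvg0P.
  apply: (@squeeze_cvgr _ _ _ _ (fun=> 0) (fun n => n.+1%:R^-1)).
  - apply: nearW => n; rewrite normr_ge0/=.
    have -> : r n x - x = ((Num.floor (n.+1%:R * x))%:~R - n.+1%:R * x) / n.+1%:R.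
      by rewrite /r; field; rewrite nat1r pnatr_eq0.
    rewrite normrM [X in _ * X]ger0_norm// ler_piMl//.
    have := floor_le (n.+1%:R * x); have := floorD1_gt (n.+1%:R * x).
    rewrite intrD1 => h1 h2; rewrite ler_norml; apply/andP; split; lra.
  - exact: cvg_cst.
  - exact: cvg_harmonic.
move=> n _ A mA; rewrite setTI.
have -> : (fun u : R * R => f (r n u.1) u.2) @^-1` A =
    \bigcup_(k : int) ([set x | Num.floor (n.+1%:R * x) = k] `*`
                       (f (k%:~R / n.+1%:R) @^-1` A)).
  apply/seteqP; split => [[x y] /= fA|[x y] /= [k _ [/= <-]]//].
  by exists (Num.floor (n.+1%:R * x)).
apply: countable_bigcupT_measurable; first exact: countableP.
move=> k; apply: measurableX; last by rewrite -[X in measurable X]setTI; exact: mf.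
have -> : [set x : R | Num.floor (n.+1%:R * x) = k] =
    `[k%:~R / n.+1%:R, (k%:~R + 1) / n.+1%:R[%classic.
  apply/seteqP; split => x /=; rewrite in_itv/= ler_pdivrMr// ltr_pdivlMr// mulrC.
    by move=> <-; rewrite floor_le -intrD1 floorD1_gt.
  by move=> ?; apply: floor_def; rewrite intrD1.
exact: measurable_itv.
Qed.

(* This is 0 <= KL(h || g), shifted by B to keep the integrand nonnegative. *)
Lemma conditional_mean_ln_ratio_le (R : realType) (g h : R -> R -> R) (B : R) (x : R) :
  (forall z, 0 < g x z) -> (forall z, 0 < h x z) ->
  measurable_fun (setT : set (measurableTypeR R)) (g x) ->
  measurable_fun (setT : set (measurableTypeR R)) (h x) ->
  (\int[lebesgue_measure]_z (g x z)%:E = 1)%E ->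
  (\int[lebesgue_measure]_z (h x z)%:E = 1)%E ->
  1 <= B -> (forall z, `|ln (g x z / h x z)| <= B) ->
  conditional_mean h (fun x z => ln (g x z / h x z) + B) x <= B.
Proof.
move=> g0 h0 mg mh ig ih B1 lB.
rewrite -lee_fin /conditional_mean.
have phi0 z : 0 <= ln (g x z / h x z) + B.
  by have := lB z; rewrite ler_norml => /andP[? _]; lra.
have : (\int[lebesgue_measure]_z ((ln (g x z / h x z) + B) * h x z)%:E <= B%:E)%E.
  (* The bound ln r <= r - 1 at r = g / h dominates the integrand by g + (B - 1) h, which integrates
     to 1 + (B - 1) = B; the assumption 1 <= B keeps the second summand nonnegative. *)
  apply: (@le_trans _ _ (\int[lebesgue_measure]_z ((g x z)%:E + ((B - 1) * h x z)%:E))%E).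
    apply: ge0_le_integral => //.
    - by move=> z _; rewrite lee_fin mulr_ge0// ltW.
    - apply/measurable_EFinP/measurable_funM => //; apply: measurable_funD => //.
      rewrite (_ : (fun z => _) = fun z => ln (g x z) - ln (h x z)).
        apply: measurable_funB; apply: measurableT_comp => //; exact: measurable_ln.
      by apply/funext => z; rewrite ln_div ?posrE.
    - apply: emeasurable_funD; apply/measurable_EFinP => //.
      exact: measurable_funM.
    - move=> z _; rewrite -EFinD lee_fin.
      have r0 : 0 < g x z / h x z by rewrite divr_gt0.
      have lnr : ln (g x z / h x z) <= g x z / h x z - 1.
        have := @le_ln1Dx R (g x z / h x z - 1); rewrite [1 + _]addrC subrK; apply.
        by rewrite ltrBrDr addNr.
      apply: (@le_trans _ _ ((g x z / h x z - 1 + B) * h x z)).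
        by rewrite ler_wpM2r ?lerD2r// ltW.
      by rewrite mulrDl mulrBl divfK ?gt_eqF//; lra.
  rewrite ge0_integralD//.
  - under [X in (_ + X)%E]eq_integral do rewrite EFinM.
    rewrite ge0_integralZl//.
    + by rewrite ih ig mule1 -EFinD lee_fin subrKC.
    + exact/measurable_EFinP.
    + by move=> z _; rewrite lee_fin ltW.
    + by rewrite lee_fin subr_ge0.
  - by move=> z _; rewrite lee_fin ltW.
  - exact/measurable_EFinP.
  - by move=> z _; rewrite lee_fin mulr_ge0 ?subr_ge0// ltW.
  - by apply/measurable_EFinP; exact: measurable_funM.
move=> le; rewrite fineK// ge0_fin_numE ?(le_lt_trans le) ?ltry//.
by apply: integral_ge0 => z _; rewrite lee_fin mulr_ge0// ltW.
Qed.

(** * Measurability of decisions and beliefs *)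

Section MeasurableIterates.
Context {R : realType} {N : nat} {Theta : finType}.
Variables (J : 'I_N -> Theta -> R -> R) (f : 'I_N -> Theta -> R -> R -> R).
Variables (W : 'M[R]_N) (alpha : nat -> R) (x0 : 'I_N -> R) (thstar : Theta).
Hypothesis f_gt0 : forall i th x y, 0 < f i th x y.
Hypothesis mf : forall i th, measurable_fun setT (fun u : R * R => f i th u.1 u.2).
Hypothesis mdJ : forall i th, measurable_fun setT (derive1 (J i th)).

Lemma measurable_fun_div_gt0 {d} {T : measurableType d} (g h : T -> R) :
  measurable_fun setT g -> measurable_fun setT h -> (forall w, 0 < h w) ->
  measurable_fun setT (fun w => g w / h w).
Proof.
move=> mg mh h0; rewrite (_ : (fun w => _) = fun w => g w * expR (- ln (h w))).
  apply: measurable_funM => //; apply: measurableT_comp; first exact: measurable_expR.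
  by apply: measurableT_comp => //; apply: measurableT_comp => //; exact: measurable_ln.
by apply/funext => w; rewrite expRN lnK ?posrE.
Qed.

Lemma measurable_log_pool {d} {T : measurableType d} (b : 'I_N -> Theta -> T -> R) i th :
  (forall j s, measurable_fun setT (b j s)) ->
  measurable_fun setT (fun w => log_pool W (fun j s => b j s w) i th).
Proof.
move=> mb; have me s : measurable_fun setT (fun w => expR (\sum_j W i j * ln (b j s w))).
  apply: measurableT_comp; first exact: measurable_expR.
  apply: measurable_sum => j; apply: measurable_funM => //.
  by apply: measurableT_comp => //; exact: measurable_ln.
apply: measurable_fun_div_gt0 => // [|w]; first exact: measurable_sum.
by rewrite (sumr_gt0 th)// => s; exact: expR_gt0.
Qed.

Lemma measurable_bayes {d} {T : measurableType d} (h q : Theta -> T -> R) a th :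
  (forall s, measurable_fun setT (h s)) -> (forall s, measurable_fun setT (q s)) ->
  (forall s w, 0 < h s w) -> (forall s w, 0 < q s w) ->
  measurable_fun setT (fun w => bayes (fun s => h s w) a (fun s => q s w) th).
Proof.
move=> mh mq h0 q0.
have mhq s : measurable_fun setT (fun w => h s w `^ a * q s w).
  apply: measurable_funM => //.
  by apply: (@measurableT_comp _ _ _ _ _ _ (@powR R ^~ a)) => //; exact: measurable_powR.
apply: measurable_fun_div_gt0 => // [|w]; first exact: measurable_sum.
by rewrite (sumr_gt0 th)// => s; rewrite mulr_gt0// powR_gt0.
Qed.

(** The sigma-algebra on [T] is left free and only earlier observations must be measurable for it,
    so that the lemma serves both for the ambient sigma-algebra and for the past at time t. *)
Lemma measurable_iterates {d} {T : measurableType d} (eps x y : nat -> 'I_N -> T -> R)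
    (q : nat -> 'I_N -> Theta -> T -> R) :
  distributed_algorithm J f W alpha x0 thstar eps x y q ->
  forall t, (forall s i, (s < t)%N -> measurable_fun setT (y s i)) ->
  (forall i, measurable_fun setT (x t i)) /\
  (forall i th, measurable_fun setT (q t i th)).
Proof.
case=> x_init q_init _ q_step x_step; elim=> [|t IH] my.
  by split=> i; [rewrite (funext (x_init i))|move=> th; rewrite (funext (q_init i th))].
have {IH}[mx mq] := IH (fun s i st => my s i (ltnW st)).
have q0 i th w : 0 < q t i th w.
  exact: (belief_gt0 (fun i th => q_init i th w) (fun t i th => q_step t i th w)).
have mqS i th : measurable_fun setT (q t.+1 i th).
  rewrite (funext (q_step t i th)).
  apply: (@measurable_log_pool _ _ (fun j th w => bayes (fun th' => f j th' (x t j w) (y t j w))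
     (alpha t) (fun th' => q t j th' w) th)) => j s.
  apply: (@measurable_bayes _ _ (fun th' w => f j th' (x t j w) (y t j w)) (q t j)) => // s'.
  apply: (@measurableT_comp _ _ _ _ _ _ (fun u : R * R => f j s' u.1 u.2) _
    (fun w => (x t j w, y t j w))) => //.
  by apply: measurable_fun_pair => //; exact: my.
split=> // i; rewrite (funext (x_step t i)).
apply: measurable_sum => j; apply: measurable_funM => //; apply: measurable_funB => //.
apply: measurable_funM => //; apply: measurable_sum => th.
by apply: measurable_funM => //; apply: measurableT_comp.
Qed.

End MeasurableIterates.

(** * The innovation series of the algorithm *)

Section InnovationSeries.
Context {R : realType} {d : measure_display} {T : measurableType d}.
Context {N : nat} {Theta : finType}.
Variables (P : probability T R) (thstar : Theta) (B C : R).
Variables (J : 'I_N -> Theta -> R -> R) (f : 'I_N -> Theta -> R -> R -> R).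
Variables (W : 'M[R]_N) (alpha : nat -> R) (x0 : 'I_N -> R).
Variables (eps : nat -> 'I_N -> {RV P >-> R}).
Variables (x y : nat -> 'I_N -> T -> R) (q : nat -> 'I_N -> Theta -> T -> R).
Hypothesis N_gt0 : (0 < N)%N.
Hypothesis mJ : forall i th, measurable_fun setT (J i th).
Hypothesis mdJ : forall i th, measurable_fun setT (derive1 (J i th)).
Hypothesis f_densities : probability_densities f.
Hypothesis f_gt0 : forall i th z v, 0 < f i th z v.
Hypothesis f_continuous : forall i th v, continuous (f i th ^~ v).
Hypothesis ln_ratio_le : forall i th th' z v, `|ln (f i th z v / f i th' z v)| <= B.
Hypothesis alpha_ge0 : forall t, 0 <= alpha t.
Hypothesis alpha_le : forall t, alpha t <= C / t.+1%:R.
Hypothesis algorithm : distributed_algorithm J f W alpha x0 thstar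
  (fun t i w => eps t i w) x y q.
Hypothesis sampling : forall t i, has_conditional_density P x y t i (f i thstar).

(** The shift by [B] makes the log-ratio nonnegative; as the densities have mass 1, it cancels in
    [innovation]. *)
Definition shifted_ln_ratio (j : 'I_N) (th : Theta) (z v : R) : R :=
  ln (f j th z v / f j thstar z v) + B.

Definition innovation (j : 'I_N) (th : Theta) (z v : R) : R :=
  shifted_ln_ratio j th z v -
  conditional_mean (f j thstar) (shifted_ln_ratio j th) z.

Let mf i th : measurable_fun setT (fun u : R * R => f i th u.1 u.2).
Proof.
apply: caratheodory_measurable => // z; by have [] := f_densities i th z.
Qed.

Let iterates_measurable t : (forall i, measurable_fun setT (x t i)) /\
  (forall i, measurable_fun setT (y t i)).
Proof.
elim/ltn_ind: t => t IH.
have [mx _] := measurable_iterates f_gt0 mf mdJ algorithm (fun s i st => (IH s st).2 i).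
split=> // i; rewrite (_ : y t i = fun w => J i thstar (x t i w) + eps t i w).
  by apply: measurable_funD => //; apply: measurableT_comp.
by apply/funext => w; case: algorithm.
Qed.

Let past_generators t := \bigcup_(s in [set s | (s < t)%N]) \bigcup_j
  (preimage_set_system setT (x s j) measurable `|`
   preimage_set_system setT (y s j) measurable).

(** The sample space carrying the past as its sigma-algebra: conditioning on the past becomes a
    property of the identity map [to_past]. *)
Let past_type t := g_sigma_algebraType (past_generators t).

Let measurable_id_past t : measurable_fun setT (idfun : T -> past_type t).
Proof.
move=> _ A mA; rewrite setTI; move: A mA; apply: smallest_sub.
  exact: sigma_algebra_measurable.
move=> A [s _ [j _ [|]]] [S mS <-].
  exact: (iterates_measurable s).1.
exact: (iterates_measurable s).2.
Qed.

Let to_past t : {mfun T >-> past_type t} :=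
  HB.pack (idfun : T -> past_type t) (isMeasurableFun.Build _ _ _ _ _ (@measurable_id_past t)).

Let past_measurable s t i : (s < t)%N ->
  measurable_fun setT (x s i : past_type t -> R) /\
  measurable_fun setT (y s i : past_type t -> R).
Proof.
move=> st; split=> _ A mA; apply: sub_sigma_algebra; exists s => //; exists i => //.
  by left; exists A.
by right; exists A.
Qed.

Let decision_past_measurable t i : measurable_fun setT (x t i : past_type t -> R).
Proof.
have [+ _] := @measurable_iterates R N Theta J f W alpha x0 thstar f_gt0 mf mdJ _
  (past_type t) _ _ _ _ algorithm t (fun s i st => (past_measurable i st).2).
exact.
Qed.

Let ratio_bounded j th z v : 0 <= shifted_ln_ratio j th z v <= B + B.
Proof.
have := ln_ratio_le j th thstar z v; rewrite ler_norml /shifted_ln_ratio => /andP[? ?].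
by apply/andP; split; lra.
Qed.

Let mratio j th : measurable_fun setT (fun u : R * R => shifted_ln_ratio j th u.1 u.2).
Proof.
apply: measurable_funD => //; apply: measurableT_comp; first exact: measurable_ln.
exact: measurable_fun_div_gt0.
Qed.

Let f_ge0 j z v : 0 <= f j thstar z v. Proof. exact: ltW. Qed.

Let int_f j z : (\int[lebesgue_measure]_v (f j thstar z v)%:E = 1)%E.
Proof. by have [] := f_densities j thstar z. Qed.

Let innovation_bounded j th z v : `|innovation j th z v| <= B + B.
Proof.
have /andP[? ?] := ratio_bounded j th z v.
have /andP[? ?] := conditional_mean_bounded (mf j thstar) (mratio j th)
  (f_ge0 j) (int_f j) (ratio_bounded j th) z.
rewrite ler_norml /innovation; apply/andP; split; lra.
Qed.

Let minnovation j th {d'} {T' : measurableType d'} (X Y : T' -> R) :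
  measurable_fun setT X -> measurable_fun setT Y ->
  measurable_fun setT (fun w => innovation j th (X w) (Y w)).
Proof.
move=> mX mY; apply: measurable_funB.
  apply: (@measurableT_comp _ _ _ _ _ _ (fun u : R * R => shifted_ln_ratio j th u.1 u.2) _
    (fun w => (X w, Y w))) => //.
  exact: measurable_fun_pair.
apply: measurableT_comp => //.
exact: measurable_conditional_mean (mf j thstar) (mratio j th) (f_ge0 j) (ratio_bounded j th).
Qed.

Let D th t w := alpha t * mean (fun j => innovation j th (x t j w) (y t j w)).

Let D_bounded th t w : `|D th t w| <= alpha t * (B + B).
Proof.
rewrite normrM ger0_norm// ler_wpM2l// -[leRHS](mean_cst _ N_gt0).
by apply: le_trans (ler_norm_mean _) _; apply: ler_mean => j.
Qed.

Let mD th t {d'} {T' : measurableType d'} (X Y : 'I_N -> T' -> R) :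
  (forall j, measurable_fun setT (X j)) -> (forall j, measurable_fun setT (Y j)) ->
  measurable_fun setT (fun w => alpha t * mean (fun j => innovation j th (X j w) (Y j w))).
Proof.
move=> mX mY; apply: measurable_funM => //; apply: measurable_funM => //.
by apply: measurable_sum => j; exact: minnovation.
Qed.

(** The earlier term is measurable for the past at time t, and each agent's innovation at time t is
    orthogonal to it; summing over the agents involves each conditional law separately, so their
    noises at one time may be dependent. *)
Let D_orthogonal th s t : (s < t)%N -> (\int[P]_w (D th s w * D th t w)%:E = 0)%E.
Proof.
move=> st.
have mDs : measurable_fun setT (D th s : past_type t -> R).
  by apply: mD => j; [exact: (past_measurable j st).1|exact: (past_measurable j st).2].
have mDT : measurable_fun setT (D th s).
  by apply: mD => j; [exact: (iterates_measurable s).1|exact: (iterates_measurable s).2].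
have DK w : `|D th s w| <= alpha s * (B + B) by [].
have I0 j : (\int[P]_w (D th s w * innovation j th (x t j w) (y t j w))%:E = 0)%E.
  exact: (innovation_orthogonal (mf j thstar) (mratio j th) (f_ge0 j) (int_f j)
    (ratio_bounded j th) (p := to_past t) (@decision_past_measurable t j)
    ((iterates_measurable t).2 j) (fun E A mE mA => sampling j mE mA) mDs DK).
have iI j : P.-integrable setT
    (fun w => (D th s w * innovation j th (x t j w) (y t j w))%:E).
  apply: (@bounded_integrable _ _ _ _ _ (alpha s * (B + B) * (B + B))).
    apply: measurable_funM => //.
    by apply: minnovation; [exact: (iterates_measurable t).1|exact: (iterates_measurable t).2].
  by move=> w; rewrite normrM ler_pM.
transitivity (\int[P]_w ((alpha t * N%:R^-1)%:E *
   \sum_j (D th s w * innovation j th (x t j w) (y t j w))%:E))%E.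
  apply: eq_integral => w _; rewrite sumEFin -EFinM; congr EFin.
  by rewrite [D th t w]/D /mean -mulr_sumr; ring.
rewrite integralZl//; last exact: integrable_sum.
by rewrite integral_sum// big1 ?mule0.
Qed.

Lemma ae_cvg_innovation_series : {ae P, forall w, forall th, cvgn (series (fun t =>
  alpha t * mean (fun j => innovation j th (x t j w) (y t j w))))}.
Proof.
apply: filter_forall => th.
have B0 : 0 <= B + B by apply: le_trans (innovation_bounded (Ordinal N_gt0) th 0 0).
apply: (@ae_cvg_orthogonal_series _ _ _ _ (D th) (C * (B + B))).
- by move=> t; apply: mD => j; [exact: (iterates_measurable t).1|exact: (iterates_measurable t).2].
- by move=> t w; apply: le_trans (D_bounded th t w) _; rewrite mulrAC ler_wpM2r.
- exact: D_orthogonal.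
Qed.

End InnovationSeries.

(** * Stepsize bounds and convergence of the decisions *)

Lemma stepsize_cvg_bounds (R : realType) (alpha : nat -> R) :
  stepsize_assumption alpha ->
  [/\ exists C, forall t, alpha t <= C / t.+1%:R, alpha @ \oo --> 0 &
      series alpha @ \oo --> +oo].
Proof.
move=> [a01 asum _ [C aC]].
have a0 t : 0 <= alpha t by have /andP[/ltW] := a01 t.
have C0 : 0 <= C by have := aC 1%N isT; rewrite divr1; apply: le_trans.
(* C / t <= 2 C / (t+1) for t >= 1, and the extra 1 covers t = 0, where alpha < 1 is the available
   bound. *)
have bound t : alpha t <= (2 * C + 1) / t.+1%:R.
  case: t => [|t]; first by have /andP[_ a1] := a01 0%N; rewrite divr1; lra.
  apply: le_trans (aC t.+1 isT) _.
  rewrite ler_pdivrMr// mulrAC ler_pdivlMr//.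
  have : t.+2%:R <= 2 * t.+1%:R :> R by rewrite -natrM ler_nat; lia.
  have : 0 <= t.+1%:R :> R by [].
  set u := t.+1%:R; set v := t.+2%:R => u0 vu.
  have : C * v <= C * (2 * u) by rewrite ler_wpM2l.
  lra.
split; first by exists (2 * C + 1).
- apply: (@squeeze_cvgr _ _ _ _ (fun=> 0) (fun t => (2 * C + 1) / t.+1%:R)).
  + by apply: nearW => t; rewrite a0 bound.
  + exact: cvg_cst.
  + rewrite -[X in _ --> X](mulr0 (2 * C + 1)); apply: cvgM; first exact: cvg_cst.
    exact: cvg_harmonic.
- apply/cvgeryP; rewrite -asum.
  rewrite [X in X @ _ --> _](_ : _ = fun n => (\sum_(0 <= t < n) (alpha t)%:E)%E).
    by apply: is_cvg_nneseries => t _ _; rewrite lee_fin.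
  by apply/funext => n /=; rewrite /series/= sumEFin.
Qed.

Theorem theorem2 (R : realType) (d : measure_display) (T : measurableType d)
    (P : probability T R) (N : nat) (Theta : finType) (thstar : Theta)
    (J : 'I_N -> Theta -> R -> R) (f : 'I_N -> Theta -> R -> R -> R)
    (g : rel 'I_N) (W : 'M[R]_N) (alpha : nat -> R) (x0 : 'I_N -> R)
    (eps : nat -> 'I_N -> {RV P >-> R})
    (x y : nat -> 'I_N -> T -> R) (q : nat -> 'I_N -> Theta -> T -> R)
    (N_gt0 : (0 < N)%N)
    (J_differentiable : forall i th z, derivable (J i th) z 1)
    (f_densities : probability_densities f)
    (W_weights : weights_of_graph g W)
    (algorithm : distributed_algorithm J f W alpha x0 thstar
                   (fun t i w => eps t i w) x y q)
    (sampling : forall t i, has_conditional_density P x y t i (f i thstar))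
    (information : bounded_information f)
    (network : network_assumption g W)
    (stepsize : stepsize_assumption alpha)
    (costs : costs_assumption J) :
  {ae P, forall w, exists qt : Theta -> R,
    [/\ limiting_belief thstar (fun t i th => q t i th w) qt,
        minimizers J qt = [set xstar J qt] &
        forall i, x t i w @[t --> \oo] --> xstar J qt]}.
Proof.
have [mu [L [mu_gt0 L_gt0 J_convex]]] := costs.
have [f_gt0 [B0 B0_gt0 ln_ratio_lt] f_continuous] := information.
have [_ _ W_stochastic /andP[_ W_radius]] := network.
have [[C alpha_le] alpha_cvg0 alpha_dvg] := stepsize_cvg_bounds stepsize.
have alpha_ge0 t : 0 <= alpha t by have [/(_ t)/andP[/ltW]] := stepsize.
(* The maximum with 1 is what the shifted Kullback-Leibler inequality asks for. *)
pose B := Num.max B0 1.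
have ln_ratio_le i th th' z v : `|ln (f i th z v / f i th' z v)| <= B.
  by apply: le_trans (ltW (ln_ratio_lt _ _ _ _ _)) _; rewrite le_max lexx.
have mJ i th : measurable_fun setT (J i th).
  apply: continuous_measurable_fun => z; apply: differentiable_continuous.
  exact/derivable1_diffP.
have mdJ i th : measurable_fun setT (derive1 (J i th)).
  apply: continuous_measurable_fun; apply: (@lipschitz_continuous _ _ L) => u v.
  by have [] := J_convex i th u v.
have := ae_cvg_innovation_series N_gt0 mJ mdJ f_densities f_gt0 f_continuous
  ln_ratio_le alpha_ge0 alpha_le algorithm sampling.
apply: filterS => w innovation_cvg.
have [_ q_init _ q_step x_step] := algorithm.
(* With the shift undone, this is minus the average over the agents of the Kullback-Leibler
   divergence from the likelihood at [th] to the one at [thstar], taken at the current decisions. *)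
pose mean_gain t th := mean (fun j =>
  conditional_mean (f j thstar) (shifted_ln_ratio thstar B f j th) (x t j w) - B).
have gain_le0 t th : mean_gain t th <= 0.
  rewrite mulr_ge0_le0 ?invr_ge0//; apply: sumr_le0 => j _; rewrite subr_le0.
  have [_ mfth int_fth] := f_densities j th (x t j w).
  have [_ mfs int_fs] := f_densities j thstar (x t j w).
  apply: conditional_mean_ln_ratio_le => //.
  by rewrite le_max lexx orbT.
have [qt [q_limit qt_ge0 qt_sum]] : exists qt : Theta -> R,
  [/\ limiting_belief thstar (fun t i th => q t i th w) qt,
      forall th, 0 <= qt th & \sum_th qt th = 1].
  apply: (belief_cvg (h := fun t i th => f i th (x t i w) (y t i w)) (B := B)
    N_gt0 W_stochastic W_radius alpha_ge0 alpha_cvg0 _ _ _ _ gain_le0).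
  - by move=> *; exact: f_gt0.
  - by move=> *; exact: ln_ratio_le.
  - by move=> *; exact: q_init.
  - by move=> *; exact: q_step.
  - move=> th; rewrite [X in series X](_ : _ = fun t => alpha t *
      mean (fun j => innovation thstar B f j th (x t j w) (y t j w))); first exact: innovation_cvg.
    apply/funext => t; rewrite /mean_gain meanB; congr (_ * mean _).
    by apply/funext => j; rewrite /innovation /shifted_ln_ratio; ring.
have [z [Gz min_z xstar_z]] :=
  minimizers_root N_gt0 mu_gt0 J_differentiable J_convex qt_ge0 qt_sum.
exists qt; rewrite xstar_z; split=> // i.
have q_gt0 t j th : 0 < q t j th w.
  exact: (belief_gt0 (fun i th => q_init i th w) (fun t i th => q_step t i th w)).
have q_sum t j : \sum_th q t j th w = 1.
  exact: (sum_belief thstar (fun i th => q_init i th w) (fun t i th => q_step t i th w)).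
apply: (decisions_cvg (h := fun t j => expected_gradient J (fun th => q t.+1 j th w) j)
  (x := fun t j => x t j w) N_gt0 W_stochastic W_radius alpha_ge0 alpha_cvg0 alpha_dvg
  mu_gt0 L_gt0 _ _ _ Gz).
- by move=> t j u v; apply: expected_gradient_monotone => // th; exact: ltW.
- by move=> t j u v; apply: expected_gradient_lipschitz => // th; exact: ltW.
- move=> j; apply: cvg_sum => th; apply: cvgM; last exact: cvg_cst.
  have [nu [_ _ qlim]] := q_limit.
  (* The decision step weighs gradients by the already updated beliefs, hence the index t+1. *)
  by have := qlim j th; rewrite -(cvg_shiftS (fun t => q t j th w)).
- by move=> t j; rewrite x_step.
Qed.
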